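(* Let $D\subsetneq\mathbb{C}$ be a simply connected domain and let $\mathfrak{U}$ be a topologically closed semigroup of holomorphic self-maps of $D$. Then the set $\mathcal{G}(\mathfrak{U})$ formed by all infinitesimal generators of one-parameter semigroups contained in $\mathfrak{U}$ is a topologically closed (real) convex cone in $\mathsf{Hol}(D,\mathbb{C})$.
   Context: For a domain $D\subset\mathbb{C}$ and a set $E\subset\mathbb{C}$, $\mathsf{Hol}(D,E)$ is the set of all holomorphic functions $f$ in $D$ with $f(D)\subset E$, endowed with the open-compact topology (locally uniform convergence in $D$). A semigroup of holomorphic self-maps of $D$ is a set $\mathfrak{U}\subset\mathsf{Hol}(D,D)$ containing the identity map $\mathrm{id}_D$ and such that $f\circ g\in\mathfrak{U}$ for any $f,g\in\mathfrak{U}$. It is topologically closed if it is (relatively) closed in $\mathsf{Hol}(D,D)$. A one-parameter semigroup in $\mathfrak{U}$ is a family $(v_t)_{t\ge0}\subset\mathfrak{U}$ such that $v_0=\mathrm{id}_D$; $v_s\circ v_t=v_{s+t}$ for all $s,t\ge0$; and $v_t\to\mathrm{id}_D$ in $\mathsf{Hol}(D,D)$ as $t\to0^+$. For every one-parameter semigroup $(v_t)$ in $\mathsf{Hol}(D,D)$, the limit $\phi:=\lim_{t\to0^+}(\mathrm{id}_D-v_t)/t$ exists in $\mathsf{Hol}(D,\mathbb{C})$ and is called the infinitesimal generator of $(v_t)$; the semigroup is determined by $\phi$ (for each $z\in D$, $t\mapsto v_t(z)$ is the unique solution of $\frac{\mathrm{d}w}{\mathrm{d}t}+\phi(w)=0$,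 $w(0)=z$). *)

(* Defs.v *)
From HB Require Import structures.
From mathcomp Require Import all_boot all_order all_algebra.
From mathcomp Require Import all_classical all_reals all_analysis.
From mathcomp Require Import complex.

Set Implicit Arguments.
Unset Strict Implicit.
Unset Printing Implicit Defensive.

Import Order.TTheory GRing.Theory Num.Theory.
Import numFieldNormedType.Exports.

Local Open Scope classical_set_scope.
Local Open Scope ring_scope.
Local Open Scope complex_scope.

(** The complex plane is [R[i]^o], with the topology of the modulus; over it,
    [derivable f z 1] is complex differentiability of [f] at [z].

    A function on [D] is represented by a total function [R[i]^o -> R[i]^o]
    whose values outside [D] are irrelevant: functions that agree on [D] are
    topologically indistinguishable in [{family compactly_in D, _ -> _}], the
    space with uniform convergence on the compact subsets of [D].  Relatively
    closed subsets of [Hol D E] therefore contain all the representatives of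
    their elements. *)

Definition domain (R : realType) (D : set R[i]^o) : Prop :=
  [/\ open D, D !=set0 & connected D].

Definition null_homotopic (R : realType) (D : set R[i]^o)
    (gamma : R -> R[i]^o) : Prop :=
  exists H : R * R -> R[i]^o,
    [/\ {within `[0, 1] `*` `[0, 1], continuous H},
        H @` (`[0, 1] `*` `[0, 1]) `<=` D,
        (forall s : R, s \in `[0, 1] -> H (0, s) = gamma s),
        (forall s : R, s \in `[0, 1] -> H (1, s) = gamma 0) &
        (forall t : R, t \in `[0, 1] ->
           H (t, 0) = gamma 0 /\ H (t, 1) = gamma 0)].

Definition simply_connected_domain (R : realType) (D : set R[i]^o) : Prop :=
  domain D /\
  forall gamma : R -> R[i]^o,
    {within `[0, 1], continuous gamma} -> gamma @` `[0, 1] `<=` D ->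
    gamma 0 = gamma 1 -> null_homotopic D gamma.

Definition Hol (R : realType) (D E : set R[i]^o) :
    set {family compactly_in D, R[i]^o -> R[i]^o} :=
  [set f | (forall z, D z -> derivable (f : R[i]^o -> R[i]^o) z 1) /\
           (forall z, D z -> E (f z))].

Arguments Hol : clear implicits.
Arguments Hol {R} D E.

Definition relatively_closed (T : topologicalType) (A B : set T) : Prop :=
  B `<=` A /\ closed (B : set (subspace A)).

Definition semigroup_of_self_maps (R : realType) (D : set R[i]^o)
    (U : set {family compactly_in D, R[i]^o -> R[i]^o}) : Prop :=
  [/\ U `<=` Hol D D, U idfun & forall f g, U f -> U g -> U (f \o g)].

Arguments semigroup_of_self_maps : clear implicits.
Arguments semigroup_of_self_maps {R} D U.

(** The values [v t] for [t < 0] are irrelevant. *)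
Definition one_parameter_semigroup (R : realType) (D : set R[i]^o)
    (U : set {family compactly_in D, R[i]^o -> R[i]^o})
    (v : R -> R[i]^o -> R[i]^o) : Prop :=
  [/\ (forall t, 0 <= t -> U (v t)),
      (forall z, D z -> v 0 z = z),
      (forall s t, 0 <= s -> 0 <= t ->
         forall z, D z -> v s (v t z) = v (s + t) z) &
      {family compactly_in D, v t @[t --> 0^'+] --> idfun}].

Arguments one_parameter_semigroup : clear implicits.
Arguments one_parameter_semigroup {R} D U v.

Definition infinitesimal_generator (R : realType) (D : set R[i]^o)
    (v : R -> R[i]^o -> R[i]^o) (phi : R[i]^o -> R[i]^o) : Prop :=
  Hol D setT phi /\
  {family compactly_in D,
    (fun z : R[i]^o => (z - v t z) / t%:C) @[t --> 0^'+] --> phi}.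

Definition generators (R : realType) (D : set R[i]^o)
    (U : set {family compactly_in D, R[i]^o -> R[i]^o}) :
    set {family compactly_in D, R[i]^o -> R[i]^o} :=
  [set phi | exists2 v, one_parameter_semigroup D U v &
                        infinitesimal_generator D v phi].

Arguments generators : clear implicits.
Arguments generators {R} D U.

Definition real_convex_cone (R : realType) (G : set (R[i]^o -> R[i]^o)) :
    Prop :=
  G !=set0 /\
  forall (a b : R) (f g : R[i]^o -> R[i]^o), 0 <= a -> 0 <= b ->
    G f -> G g -> G (fun z => a%:C * f z + b%:C * g z).

(* Main.v *)
Require Import Defs.
From mathcomp Require Import all_boot all_order all_algebra.
From mathcomp Require Import all_classical all_reals all_analysis.
From mathcomp Require Import complex.
From mathcomp Require Import ring lra.

(** The proof rests on a criterion: a holomorphic [phi] generates a semigroup in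
    [U] as soon as, on every compact set and up to every [e > 0], it is a
    difference quotient [(id - g) / h] with [g] in [U] and [0 < h < e].  The
    criterion is obviously stable under locally uniform limits; it is stable under
    nonnegative combinations since [v_(a h) o w_(b h)] has a difference quotient
    close to [a phi + b psi].

    To construct the semigroup, let [u_t] be the limit of the Euler polygons
    [g^floor(t / h)] along an ultrafilter of such pairs [(g, h)].  The polygons stay
    in compact sets: Harnack's inequality bounds [1 - |q (g z)|] by
    [(1 + C h) (1 - |q z|)] uniformly over holomorphic [q : D -> disc], so that,
    replacing [q] by [q o g^k], [1 - |q (g^k z)| <= exp (C T) (1 - |q z|)] for
    [k h <= T]; and the points satisfying this for all [q] form a relatively compact
    set, as shown by the roots of [b - p] where [b] is a bounded injective
    holomorphic function on [D] and [p] is outside of [b(D)].  Simple connectedness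
    enters only through the existence of holomorphic square roots, which also give
    [b].  Bounded holomorphic functions are equi-Lipschitz, hence the convergence
    is locally uniform and [u_t] is a semigroup, and [z - u_t z = t phi z + o(t)].

    The function theory comes from Goursat's lemma on squares, with finitely many
    exceptional points: it gives a crude Cauchy estimate, sharpened to the maximum
    principle by taking powers.  Applied to the difference quotients
    [(f w - f z) / (w - z)], the latter yields Schwarz's lemma, Lipschitz bounds and
    Weierstrass' theorem. *)

Set Implicit Arguments.
Unset Strict Implicit.
Unset Printing Implicit Defensive.

Import Order.TTheory GRing.Theory Num.Theory.
Import numFieldNormedType.Exports.

Local Open Scope classical_set_scope.
Local Open Scope ring_scope.
Local Open Scope complex_scope.

Local Notation Re := complex.Re.
Local Notation Im := complex.Im.

(** * Modulus, continuity and complex derivatives *)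

Section Modulus.
Context {R : realType}.
Local Notation C := R[i].
Implicit Types z w : C.

(** The norm of [R[i]] takes its values in [R[i]] itself; this real-valued copy keeps the estimates
    in an ordered field, within reach of [lra]. *)
Definition modulus (z : R[i]) : R := Num.sqrt (Re z ^+ 2 + Im z ^+ 2).
Local Notation nm := modulus.

Lemma normC_modulus (z : R[i]) : `|z| = (nm z)%:C.
Proof. exact: normc_def. Qed.

Lemma modulus_ge0 (z : R[i]) : 0 <= nm z. Proof. exact: sqrtr_ge0. Qed.

Lemma modulus0 : nm (0 : R[i]) = 0.
Proof. by apply: complexI; rewrite -normC_modulus normr0. Qed.

Lemma modulus1 : nm (1 : R[i]) = 1.
Proof. by apply: complexI; rewrite -normC_modulus normr1. Qed.

Lemma modulus_eq0 (z : R[i]) : (nm z == 0) = (z == 0).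
Proof. by rewrite -(inj_eq (@complexI R)) -normC_modulus normr_eq0. Qed.

Lemma modulus_gt0 (z : R[i]) : (0 < nm z) = (z != 0).
Proof. by rewrite lt0r modulus_ge0 andbT modulus_eq0. Qed.

Lemma modulusN (z : R[i]) : nm (- z) = nm z.
Proof. by apply: complexI; rewrite -!normC_modulus normrN. Qed.

Lemma modulusB (z w : R[i]) : nm (z - w) = nm (w - z).
Proof. by rewrite -modulusN opprB. Qed.

Lemma modulusM (z w : R[i]) : nm (z * w) = nm z * nm w.
Proof. by apply: complexI; rewrite rmorphM/= -!normC_modulus normrM. Qed.

Lemma modulusX (z : R[i]) n : nm (z ^+ n) = nm z ^+ n.
Proof. by elim: n => [|n IH]; rewrite ?modulus1// !exprS modulusM IH. Qed.

Lemma modulusV (z : R[i]) : nm z^-1 = (nm z)^-1.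
Proof.
have [->|z0] := eqVneq z 0; first by rewrite !(invr0, modulus0).
apply: (@mulIf _ (nm z)); first by rewrite modulus_eq0.
by rewrite -modulusM !mulVf ?modulus_eq0// modulus1.
Qed.

Lemma ler_modulusD (z w : R[i]) : nm (z + w) <= nm z + nm w.
Proof. by rewrite -lecR rmorphD/= -!normC_modulus; apply: ler_normD. Qed.

Lemma ler_modulusB (z w : R[i]) : nm (z - w) <= nm z + nm w.
Proof. by rewrite -(modulusN w) ler_modulusD. Qed.

Lemma modulus_real (x : R) : nm x%:C = `|x|.
Proof. by rewrite /modulus /= expr0n addr0 sqrtr_sqr. Qed.

Lemma ler_Re_modulus (z : R[i]) : `|Re z| <= nm z.
Proof. by rewrite -lecR -normC_modulus normc_ge_Re. Qed.

Lemma ler_Im_modulus (z : R[i]) : `|Im z| <= nm z.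
Proof. by rewrite -sqrtr_sqr ler_wsqrtr// lerDr sqr_ge0. Qed.

Lemma ler_modulus_ReIm (z : R[i]) : nm z <= `|Re z| + `|Im z|.
Proof.
rewrite -[leRHS]ger0_norm ?addr_ge0// -sqrtr_sqr ler_wsqrtr//.
by rewrite sqrrD !real_normK ?num_real// lerD2r lerDl mulrn_wge0// mulr_ge0.
Qed.

Lemma ball_modulus (z w : R[i]^o) (e : R) : ball z e%:C w <-> nm (w - z) < e.
Proof. by rewrite -ball_normE /ball_ /= normC_modulus ltcR modulusB. Qed.

Lemma posC_real (e : C) : 0 < e -> exists2 d : R, 0 < d & e = d%:C.
Proof.
move=> e0; exists (Re e).
  by move: e0; rewrite ltcE => /andP[].
by rewrite RRe_real// realE ltW.
Qed.

Lemma nbhs_modulusP (z : R[i]^o) (A : set R[i]^o) :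
  nbhs z A <-> exists2 d : R, 0 < d & forall w : C, nm (w - z) < d -> A w.
Proof.
split => [/nbhs_ballP[e /= e0 eA]|[d d0 dA]].
  have [d d0 ed] := posC_real e0; subst e.
  by exists d => // w wz; apply: eA; apply/ball_modulus.
apply/nbhs_ballP; exists d%:C => /=; first by rewrite ltcR.
by move=> w /ball_modulus; exact: dA.
Qed.

Lemma cvg_modulusP (T : Type) (F : set_system T) {FF : Filter F}
    (f : T -> R[i]^o) (z : R[i]^o) :
  f @ F --> z <-> forall e : R, 0 < e -> \forall x \near F, nm ((f x : C) - z) < e.
Proof.
split=> [fz e e0|fz].
  by apply: (fz [set w : R[i]^o | nm ((w : C) - z) < e]); apply/nbhs_modulusP; exists e.
by move=> A /nbhs_modulusP[d d0 dA]; apply: filterS (fz _ d0) => x; exact: dA.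
Qed.

Definition ccont (f : C -> C) z :=
  forall e : R, 0 < e -> exists2 d : R, 0 < d &
    forall w, nm (w - z) < d -> nm (f w - f z) < e.

Lemma ccontP (f : R[i]^o -> R[i]^o) (z : R[i]^o) :
  {for z, continuous f} <-> ccont f z.
Proof.
split=> [/cvg_modulusP fz e e0|fz].
  by have /nbhs_modulusP := fz _ e0.
by apply/(@cvg_modulusP _ (nbhs z)) => e e0; apply/nbhs_modulusP; exact: fz.
Qed.

Lemma ccont_cst c z : ccont (fun=> c) z.
Proof. by move=> e e0; exists 1 => // w _; rewrite subrr modulus0. Qed.

Lemma ccont_id z : ccont id z.
Proof. by move=> e e0; exists e. Qed.

Lemma ccont_comp f g z : ccont f z -> ccont g (f z) -> ccont (fun w => g (f w)) z.
Proof.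
move=> fz gz e e0; have [d d0 h] := gz _ e0; have [d' d'0 h'] := fz _ d0.
by exists d' => // w wz; exact/h/h'.
Qed.

Lemma ccontD f g z : ccont f z -> ccont g z -> ccont (fun w => f w + g w) z.
Proof.
move=> fz gz e e0; have e2 : 0 < e / 2 by lra.
have [d d0 h] := fz _ e2; have [d' d'0 h'] := gz _ e2.
exists (Num.min d d'); first by rewrite lt_min d0.
move=> w; rewrite lt_min => /andP[/h hf /h' hg].
rewrite opprD addrACA; apply: le_lt_trans (ler_modulusD _ _) _; lra.
Qed.

Lemma ccontM f g z : ccont f z -> ccont g z -> ccont (fun w => f w * g w) z.
Proof.
move=> fz gz e e0; have f0 := modulus_ge0 (f z); have g0 := modulus_ge0 (g z).
have e1 : 0 < Num.min 1 (e / (2 * (1 + nm (g z)))).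
  by rewrite lt_min ltr01 divr_gt0//; lra.
have e2 : 0 < e / (2 * (1 + nm (f z))) by rewrite divr_gt0//; lra.
have [d d0 h] := fz _ e1; have [d' d'0 h'] := gz _ e2.
exists (Num.min d d'); first by rewrite lt_min d0.
move=> w; rewrite lt_min => /andP[/h + /h'].
rewrite lt_min !ltr_pdivlMr; [|lra|lra] => /andP[hf1 hf] hg.
rewrite (_ : _ - _ = f w * (g w - g z) + (f w - f z) * g z); last by ring.
apply: le_lt_trans (ler_modulusD _ _) _; rewrite !modulusM.
have : nm (f w) <= 1 + nm (f z).
  rewrite -[f w in leLHS](subrK (f z)); apply: le_trans (ler_modulusD _ _) _; lra.
have := modulus_ge0 (g w - g z); have := modulus_ge0 (f w - f z).
move: (nm (f w - f z)) (nm (g w - g z)) (nm (f w)) hf1 hf hg f0 g0.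
by move: (nm (f z)) (nm (g z)) => a b x y t *; nra.
Qed.

Lemma ccontN f z : ccont f z -> ccont (fun w => - f w) z.
Proof.
move=> fz e e0; have [d d0 h] := fz _ e0; exists d => // w /h.
by rewrite -opprD modulusN.
Qed.

Lemma ccontV f z : f z != 0 -> ccont f z -> ccont (fun w => (f w)^-1) z.
Proof.
move=> f0 fz e e0; have fz0 : 0 < nm (f z) by rewrite modulus_gt0.
have e1 : 0 < Num.min (nm (f z) / 2) (e * (nm (f z) ^+ 2 / 2)).
  by rewrite lt_min divr_gt0// mulr_gt0// divr_gt0// exprn_gt0.
have [d d0 h] := fz _ e1; exists d => // w /h; rewrite lt_min => /andP[h1 h2].
have fw : nm (f z) / 2 < nm (f w).
  have := ler_modulusD (f z - f w) (f w); rewrite subrK modulusB; lra.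
have fw0 : f w != 0 by rewrite -modulus_gt0; lra.
rewrite (_ : _ - _ = (f z - f w) / (f w * f z)); last by field; rewrite f0.
rewrite modulusM modulusV modulusM modulusB ltr_pdivrMr; last nra.
apply: lt_le_trans h2 _; rewrite ler_wpM2l//; first exact: ltW.
by rewrite expr2 mulrAC ler_wpM2r ?modulus_ge0// ltW.
Qed.

(* Caratheodory's form of differentiability: the rules of calculus reduce to
   those of continuity. *)
Definition cdiff (f : C -> C) z (l : C) :=
  exists2 q : C -> C, ccont q z & q z = l /\ forall w, f w = f z + q w * (w - z).

Lemma cdiffP f z l : cdiff f z l <->
  forall e : R, 0 < e -> exists2 d : R, 0 < d & forall w, nm (w - z) < d ->
    nm (f w - f z - l * (w - z)) <= e * nm (w - z).
Proof.
split=> [[q qc [<- fq]] e e0|h].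
  have [d d0 dq] := qc _ e0; exists d => // w /dq wq.
  by rewrite fq [f z + _]addrC addrK -mulrBl modulusM ler_wpM2r ?modulus_ge0// ltW.
exists (fun w => if w == z then l else (f w - f z) / (w - z)); last first.
  rewrite eqxx; split => // w; have [->|wz] := eqVneq; first by rewrite subrr mulr0 addr0.
  by rewrite mulfVK ?subr_eq0// addrC subrK.
move=> e e0; have e2 : 0 < e / 2 by lra.
have [d d0 dq] := h _ e2; exists d => // w /dq; rewrite eqxx.
have [->|wz] := eqVneq; first by rewrite (subrr l) modulus0.
rewrite -{1}(mulfVK (_ : w - z != 0) (f w - f z)) ?subr_eq0// -mulrBl modulusM.
rewrite ler_pM2r ?modulus_gt0 ?subr_eq0// => /le_lt_trans; apply; lra.
Qed.

Lemma derivable_cdiff (f : R[i]^o -> R[i]^o) (z : R[i]^o) :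
  derivable f z 1 <-> exists l, cdiff f z l.
Proof.
split.
  move=> /cvg_ex[l /= hl]; exists l; apply/cdiffP => e e0.
  move: hl => /cvg_modulusP/(_ _ e0)/nbhs_modulusP[d d0 dq].
  exists d => // w wz; have [->|wz0] := eqVneq w z.
    by rewrite !subrr mulr0 subr0 modulus0 mulr0.
  have wz1 : w - z != 0 by rewrite subr_eq0.
  have := dq (w - z); rewrite subr0 => /(_ wz wz1).
  rewrite /GRing.scale /= mulr1 subrK => h.
  have -> : f w - f z - l * (w - z) = ((w - z)^-1 * (f w - f z) - l) * (w - z).
    by rewrite mulrBl mulrAC mulVf// mul1r.
  by rewrite modulusM ler_wpM2r ?modulus_ge0// ltW.
move=> [l /cdiffP h]; apply/cvg_ex; exists l; apply/cvg_modulusP => e e0.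
have e2 : 0 < e / 2 by lra.
have [d d0 dq] := h _ e2; apply/nbhs_modulusP; exists d => // w; rewrite subr0 => wd w0.
have := dq (w + z); rewrite addrK => /(_ wd).
rewrite /GRing.scale /= mulr1.
have -> : f (w + z) - f z - l * w = (w^-1 * (f (w + z) - f z) - l) * w.
  by rewrite mulrBl mulrAC mulVf// mul1r.
rewrite modulusM ler_pM2r ?modulus_gt0// => /le_lt_trans; apply; lra.
Qed.

Lemma cdiff_cont f z l : cdiff f z l -> ccont f z.
Proof.
move=> [q qc [_ fq]]; rewrite (_ : f = fun w => f z + q w * (w - z)); last exact/funext.
apply: ccontD; first exact: ccont_cst.
apply: ccontM => //; apply: ccontD; [exact: ccont_id|exact: ccont_cst].
Qed.

Lemma cdiff_cst c z : cdiff (fun=> c) z 0.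
Proof.
exists (fun=> 0); first exact: ccont_cst.
by split => // w; rewrite mul0r addr0.
Qed.

Lemma cdiff_id z : cdiff id z 1.
Proof.
exists (fun=> 1); first exact: ccont_cst.
by split => // w; rewrite mul1r addrC subrK.
Qed.

Lemma cdiffD f g z l m : cdiff f z l -> cdiff g z m -> cdiff (fun w => f w + g w) z (l + m).
Proof.
move=> [q qc [ql fq]] [p pc [pm gp]]; exists (fun w => q w + p w); first exact: ccontD.
by split => [|w]; rewrite ?ql ?pm// fq gp; ring.
Qed.

Lemma cdiffM f g z l m : cdiff f z l -> cdiff g z m ->
  cdiff (fun w => f w * g w) z (l * g z + f z * m).
Proof.
move=> df dg; have gc := cdiff_cont dg.
move: df dg => [q qc [ql fq]] [p pc [pm gp]].
exists (fun w => q w * g w + f z * p w).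
  apply: ccontD; first exact: ccontM.
  by apply: ccontM => //; exact: ccont_cst.
by split => [|w]; rewrite ?ql ?pm// (fq w) (gp w); ring.
Qed.

Lemma cdiffN f z l : cdiff f z l -> cdiff (fun w => - f w) z (- l).
Proof.
move=> [q qc [ql fq]]; exists (fun w => - q w); first exact: ccontN.
by split => [|w]; rewrite ?ql// fq; ring.
Qed.

Lemma cdiffV f z l : f z != 0 -> cdiff f z l -> exists m, cdiff (fun w => (f w)^-1) z m.
Proof.
move=> fz df; have fc := cdiff_cont df; move: df => [q qc [_ fq]].
(* Where [f w = 0], the convention [0^-1 = 0] breaks the algebraic formula; the literal quotient
   keeps the factorisation valid for every [w]. Continuity at [z] only sees the other case. *)
pose p w := if f w == 0 then (fun w => ((f w)^-1 - (f z)^-1) / (w - z)) w else - q w / (f w * f z).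
exists (p z); exists p; last first.
  split => // w; rewrite /p /=; case: eqVneq => fw.
    have wz : w - z != 0.
      by rewrite subr_eq0; apply: contra_neq fz => <-.
    by rewrite mulfVK// addrC subrK.
  rewrite (_ : - q w / (f w * f z) * (w - z) = (f z - f w) / (f w * f z)).
    by field; rewrite fw fz.
  by rewrite (fq w); ring.
have pE : ccont (fun w => - q w / (f w * f z)) z.
  apply: ccontM; first exact: ccontN.
  apply: ccontV; first by rewrite mulf_neq0.
  by apply: ccontM => //; exact: ccont_cst.
have fz0 : 0 < nm (f z) by rewrite modulus_gt0.
have [d1 d10 dq1] := fc _ fz0.
move=> e e0; have [d d0 dq] := pE _ e0.
exists (Num.min d1 d); first by rewrite lt_min d10.
move=> w; rewrite lt_min => /andP[/dq1 w1 /dq].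
rewrite /p (negbTE fz); case: eqVneq => // fw; move: w1.
by rewrite fw sub0r modulusN ltxx.
Qed.

Lemma cdiff_comp f g z l m : cdiff f z l -> cdiff g (f z) m ->
  cdiff (fun w => g (f w)) z (m * l).
Proof.
move=> df; have fc := cdiff_cont df; move: df => [q qc [ql fq]] [p pc [pm gp]].
exists (fun w => p (f w) * q w).
  by apply: ccontM => //; exact: (ccont_comp fc).
split; first by rewrite pm ql.
by move=> w; rewrite gp -mulrA; congr (_ + _ * _); rewrite fq; ring.
Qed.

End Modulus.
Local Notation nm := modulus.

(** * Goursat's lemma and the Cauchy estimate *)

Section Goursat.
Context {R : realType}.
Local Notation C := R[i].

Lemma primitive_exists (g : R -> R) (a : R) : continuous g ->
  exists G : R -> R, forall x, a < x -> is_derive x 1 G (g x).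
Proof.
move=> gc; exists (fun x => \int[lebesgue_measure]_(t in `[a, x]) g t)%R => x ax.
have [|||| d e] := @continuous_FTC1_closed R g a x (x + 1).
- lra.
- apply: continuous_compact_integrable; first exact: segment_compact.
  exact: continuous_subspaceT.
- by [].
- exact: gc.

split; first exact: d.
by rewrite -derive1E; exact: e.
Qed.

Lemma MVT_le (G : R -> R) (g : R -> R) (x y : R) : x <= y ->
  (forall t, x <= t <= y -> is_derive t 1 G (g t)) ->
  exists2 t, x <= t <= y & G y - G x = g t * (y - x).
Proof.
rewrite le_eqVlt => /predU1P[<- _|xy dG].
  by exists x; rewrite ?lexx// !subrr mulr0.
have [||t] := @MVT _ G g _ _ xy.
- move=> t; rewrite in_itv /= => /andP[tx ty].
  by apply: dG; rewrite !ltW.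
- apply: derivable_within_continuous => t; rewrite in_itv /= => tt.
  by case: (dG t tt).
rewrite in_itv /= => /andP[tx ty] ->; exists t => //.
by rewrite !ltW.
Qed.

(** The mean value theorem for [G \- P]; it replaces the bound of an integral by the supremum of the
    integrand. *)
Lemma primitive_close (G P g p : R -> R) (x y c : R) : x <= y ->
  (forall t, x <= t <= y -> is_derive t 1 G (g t)) ->
  (forall t, x <= t <= y -> is_derive t 1 P (p t)) ->
  (forall t, x <= t <= y -> `|g t - p t| <= c) ->
  `|(G y - G x) - (P y - P x)| <= c * (y - x).
Proof.
move=> xy dG dP gp.
have [t txy] : exists2 t, x <= t <= y &
    (G \- P) y - (G \- P) x = (g t - p t) * (y - x).
  apply: MVT_le => // t tt; have := dG t tt; have := dP t tt => ? ?.
  exact: is_deriveB.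
rewrite /= (_ : _ - _ - (_ - _) = G y - G x - (P y - P x)); last by ring.
move=> ->; rewrite normrM (@ger0_norm _ (y - x)) ?subr_ge0// ler_wpM2r ?subr_ge0//.
exact: gp.
Qed.

(** The supremum of the left ends works, as every right end bounds all left ends. *)
Lemma nested_segments (x t : nat -> R) : (forall n, 0 <= t n) ->
  (forall n, x n <= x n.+1) -> (forall n, x n.+1 + t n.+1 <= x n + t n) ->
  exists p, forall n, x n <= p <= x n + t n.
Proof.
move=> t0 xS xtS.
have xm n k : x n <= x (n + k)%N.
  by elim: k => [|k]; rewrite ?addn0// addnS => /le_trans; apply.
have xtm n k : x (n + k)%N + t (n + k)%N <= x n + t n.
  by elim: k => [|k]; rewrite ?addn0// addnS; apply: le_trans.
have xxt n k : x k <= x n + t n.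
  have [nk|kn] := leqP n k.
    by have := xtm n (k - n)%N; rewrite subnKC//; apply: le_trans; rewrite lerDl.
  have := xm k (n - k)%N; rewrite subnKC 1?ltnW// => /le_trans; apply.
  by rewrite lerDl.
have hub n : ubound (range x) (x n + t n) by move=> _ [k _ <-].
have hs : has_sup (range x) by split; [exists (x 0%N); exists 0%N|exists (x 0%N + t 0%N)].
exists (sup (range x)) => n; apply/andP; split.
  by apply: ub_le_sup; [case: hs|exists n].
by apply: ge_sup; [case: hs|exact: hub].
Qed.

(* An increasing function of slope at least one whose increments dominate the
   square root of the length on segments meeting [E]: products of its
   increments form an additive measure of squares that dominates the perimeter
   near the exceptional points. *)
Lemma sqrt_scale (E : seq R) : exists A : R -> R,
  forall x t : R, 0 <= t -> t <= A (x + t) - A x /\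
    forall p, p \in E -> x <= p <= x + t -> Num.sqrt t <= A (x + t) - A x.
Proof.
elim: E => [|p E [A AE]].
  by exists id => x t t0; split=> //; rewrite addrAC subrr add0r.
(* [S] is the odd square root: each exceptional point [p] adds a summand [S (u - p)], infinitely
   steep at [p]. *)
pose S (u : R) := if 0 <= u then Num.sqrt u else - Num.sqrt (- u).
have Sm u v : u <= v -> S u <= S v.
  rewrite /S => uv; case: ifPn => u0; case: ifPn => v0.
  - by rewrite ler_wsqrtr.
  - lra.
  - by rewrite (@le_trans _ _ 0) ?oppr_le0 ?sqrtr_ge0.
  - by rewrite lerN2 ler_wsqrtr// lerN2.
exists (fun u => A u + S (u - p)) => x t t0.
have Sxy : S (x - p) <= S (x + t - p) by apply: Sm; lra.
have [A1 A2] := AE x _ t0; split; first lra.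
move=> q; rewrite inE => /predU1P[->{q}|qE] xqy; last first.
  by have := A2 _ qE xqy; lra.
suff : Num.sqrt t <= S (x + t - p) - S (x - p).
  have := le_trans t0 A1; lra.
move: xqy => /andP[xp py].
rewrite {1}/S subr_ge0 py /S subr_ge0.
have -> : - (if p <= x then Num.sqrt (x - p) else - Num.sqrt (- (x - p))) = Num.sqrt (p - x).
  case: ifPn => [px|_]; last by rewrite opprK opprB.
  have -> : x = p by lra.
  by rewrite subrr sqrtr0 oppr0.
(* For [p] in the segment, subadditivity of the square root: [t] is the sum of [x + t - p] and
   [p - x]. *)
have h1 := sqrtr_ge0 (x + t - p); have h2 := sqrtr_ge0 (p - x).
rewrite -[leRHS]ger0_norm ?addr_ge0// -sqrtr_sqr ler_wsqrtr// sqrrD.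
rewrite !sqr_sqrtr ?subr_ge0//.
have : 0 <= Num.sqrt (x + t - p) * Num.sqrt (p - x) by rewrite mulr_ge0.
lra.
Qed.

Definition in_square (a b s : R) (z : C) := (a <= Re z <= a + s) && (b <= Im z <= b + s).

Section squares.
(* Integrals are replaced by increments of the primitives [PH y] and [PV x] of
   [Re f] and [Im f] along horizontal and vertical lines. *)
Variables (f : C -> C) (a b s : R) (PH PV : R -> R -> R).
Hypothesis s0 : 0 <= s.
Hypothesis dPH : forall x y, a <= x <= a + s -> b <= y <= b + s ->
  is_derive x 1 (PH y) (Re (f (x +i* y))).
Hypothesis dPV : forall x y, a <= x <= a + s -> b <= y <= b + s ->
  is_derive y 1 (PV x) (Im (f (x +i* y))).

(* The real part of the integral of [f dz] along the boundary. *)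
Let I (x y t : R) := (PH y (x + t) - PH y x) - (PH (y + t) (x + t) - PH (y + t) x)
  - (PV (x + t) (y + t) - PV (x + t) y) + (PV x (y + t) - PV x y).

(** An affine function has the explicit primitives [QH] and [QV], whose increments cancel around the
    square; each of the four sides then contributes an error of at most [eta * t]. *)
Lemma square_affine (x y t : R) c l eta : 0 <= t ->
  a <= x -> x + t <= a + s -> b <= y -> y + t <= b + s ->
  (forall w, in_square x y t w -> nm (f w - (c + l * w)) <= eta) ->
  `|I x y t| <= 4 * eta * t.
Proof.
move=> t0 ax xa yb by_ hf.
case: c hf => c1 c2 hf; case: l hf => l1 l2 hf.
pose QH v (u : R) := (c1 - l2 * v) * u + l1 / 2 * u ^+ 2.
pose QV u (v : R) := (c2 + l2 * u) * v + l1 / 2 * v ^+ 2.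
have dQ (k m u : R) : is_derive u 1 (fun u => k * u + m / 2 * u ^+ 2) (k + m * u).
  rewrite (_ : (fun _ => _) = k *: id + (m / 2) *: (id ^+ 2)); last first.
    by apply/funext => v.
  have h := is_deriveD (is_deriveZ k (is_derive_id u 1)) (is_deriveZ (m / 2) (is_deriveX 2 (is_derive_id u 1))).
  apply: (@is_derive_eq _ _ _ _ _ _ _ _ h).
  rewrite /GRing.scale /=; lra.
have H v : y <= v <= y + t ->
    `|(PH v (x + t) - PH v x) - (QH v (x + t) - QH v x)| <= eta * t.
  move=> yv; rewrite -{3}(_ : x + t - x = t); last by ring.
  apply: (@primitive_close _ _ (fun u => Re (f (u +i* v))) (fun u => (c1 - l2 * v) + l1 * u)
    _ _ _ _ _ (fun u _ => dQ _ _ u)).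
  - by lra.
  - by move=> u xu; apply: dPH; lra.
  - move=> u xu; apply: le_trans (hf (u +i* v) _); last by rewrite /in_square /= xu yv.
    apply: le_trans (ler_Re_modulus _); rewrite le_eqVlt; apply/orP; left; apply/eqP.
    by congr `|_|; rewrite raddfB /=; ring.
have V u : x <= u <= x + t ->
    `|(PV u (y + t) - PV u y) - (QV u (y + t) - QV u y)| <= eta * t.
  move=> xu; rewrite -{3}(_ : y + t - y = t); last by ring.
  apply: (@primitive_close _ _ (fun v => Im (f (u +i* v))) (fun v => (c2 + l2 * u) + l1 * v)
    _ _ _ _ _ (fun v _ => dQ _ _ v)).
  - by lra.
  - by move=> v yv; apply: dPV; lra.
  - move=> v yv; apply: le_trans (hf (u +i* v) _); last by rewrite /in_square /= xu yv.
    apply: le_trans (ler_Im_modulus _); rewrite le_eqVlt; apply/orP; left; apply/eqP.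
    by congr `|_|; rewrite raddfB /=; ring.
have yy : y <= y <= y + t by lra.
have yt : y <= y + t <= y + t by lra.
have xx : x <= x <= x + t by lra.
have xt : x <= x + t <= x + t by lra.
move: (H _ yy) (H _ yt) (V _ xx) (V _ xt).
rewrite /I /QH /QV !ler_norml; lra.
Qed.


Variable E : seq C.
Hypothesis fE : forall z, in_square a b s z -> z \in E -> ccont f z.
Hypothesis fD : forall z, in_square a b s z -> z \notin E -> exists l, cdiff f z l.

(* Bisection: a square violating [|I| <= e * mu] contains smaller and smaller
   ones, shrinking to a point where the local estimates contradict it. *)
Lemma goursat : I a b s = 0.
Proof.
have [A1 A1P] := sqrt_scale [seq Re z | z <- E].
have [A2 A2P] := sqrt_scale [seq Im z | z <- E].
(* [mu] is additive under bisection, at least the area of the square, and at least its side when the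
   square contains an exceptional point. *)
pose mu (x y t : R) := (A1 (x + t) - A1 x) * (A2 (y + t) - A2 y).
suff small (e : R) : 0 < e -> `|I a b s| <= e * mu a b s.
  apply/eqP; rewrite -normr_le0; apply/ler_addgt0Pl => /= e e0; rewrite addr0.
  have mu0 : 0 <= mu a b s.
    have [h1 _] := A1P a s s0.
    have [h2 _] := A2P b s s0.
    by apply: mulr_ge0; [apply: le_trans h1|apply: le_trans h2].
  have e1 : 0 < e / (1 + mu a b s) by rewrite divr_gt0//; lra.
  apply: le_trans (small _ e1) _.
  by rewrite mulrAC ler_pdivrMr ?ler_pM2l//; lra.
move=> e0; rewrite leNgt; apply/negP => bad0.
pose bad (q : R * R) n := e * mu q.1 q.2 (s / 2 ^+ n) < `|I q.1 q.2 (s / 2 ^+ n)|.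
(* If all four quarters were good, additivity of [I] and [mu] would make the whole square good. *)
have step (q : (R * R) * nat) : exists q' : R * R, bad q.1 q.2 ->
    [/\ bad q' q.2.+1, q'.1 = q.1.1 \/ q'.1 = q.1.1 + s / 2 ^+ q.2.+1 &
        q'.2 = q.1.2 \/ q'.2 = q.1.2 + s / 2 ^+ q.2.+1].
  case: q => -[x y] n; apply/not_existsP => /= nq.
  have [bn _] : bad (x, y) n /\ True.
    by split=> //; apply: contrapT => nb; apply: (nq (x, y)) => /nb.
  pose t := s / 2 ^+ n.+1.
  have tE : s / 2 ^+ n = t + t by rewrite /t exprS invfM; field; rewrite expf_neq0.
  have good x' y' : x' = x \/ x' = x + t -> y' = y \/ y' = y + t ->
      `|I x' y' t| <= e * mu x' y' t.
    move=> hx hy; rewrite leNgt; apply/negP => bb.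
    by apply: (nq (x', y')) => _; split.
  have h1 := good x y (or_introl erefl) (or_introl erefl).
  have h2 := good (x + t) y (or_intror erefl) (or_introl erefl).
  have h3 := good x (y + t) (or_introl erefl) (or_intror erefl).
  have h4 := good (x + t) (y + t) (or_intror erefl) (or_intror erefl).
  move: bn; rewrite /bad /= tE; apply/negP; rewrite -leNgt.
  have -> : I x y (t + t) = I x y t + I (x + t) y t + I x (y + t) t + I (x + t) (y + t) t.
    by rewrite /I !addrA; ring.
  have -> : mu x y (t + t) = mu x y t + mu (x + t) y t + mu x (y + t) t + mu (x + t) (y + t) t.
    by rewrite /mu !addrA; ring.
  rewrite !mulrDr; apply: le_trans (ler_normD _ _) _; apply: lerD => //.
  apply: le_trans (ler_normD _ _) _; apply: lerD => //.
  by apply: le_trans (ler_normD _ _) _; apply: lerD.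
have [next nextP] := choice step.
pose q := fix q n := if n is m.+1 then next (q m, m) else (a, b).
have badq n : bad (q n) n.
  elim: n => [|n]; first by rewrite /bad /= expr0 divr1.
  by move=> /(nextP (q n, n))[].
pose t n := s / 2 ^+ n.
have tn n : t n = t n.+1 + t n.+1 by rewrite /t exprS invfM; field; rewrite expf_neq0.
have t0 n : 0 <= t n by rewrite divr_ge0// exprn_ge0.
have qS1 n : (q n).1 <= (q n.+1).1 /\ (q n.+1).1 + t n.+1 <= (q n).1 + t n.
  have [_ /= [] -> _] := nextP (q n, n) (badq n); rewrite -/(t n.+1) (tn n);
  have := t0 n.+1; split; lra.
have qS2 n : (q n).2 <= (q n.+1).2 /\ (q n.+1).2 + t n.+1 <= (q n).2 + t n.
  have [_ /= _ [] ->] := nextP (q n, n) (badq n); rewrite -/(t n.+1) (tn n);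
  have := t0 n.+1; split; lra.
have [p1 p1P] := nested_segments t0 (fun n => (qS1 n).1) (fun n => (qS1 n).2).
have [p2 p2P] := nested_segments t0 (fun n => (qS2 n).1) (fun n => (qS2 n).2).
have qa n : a <= (q n).1 /\ (q n).1 + t n <= a + s.
  elim: n => [|n [IH1 IH2]]; first by rewrite /t /= expr0 divr1.
  by have [h1 h2] := qS1 n; split; lra.
have qb n : b <= (q n).2 /\ (q n).2 + t n <= b + s.
  elim: n => [|n [IH1 IH2]]; first by rewrite /t /= expr0 divr1.
  by have [h1 h2] := qS2 n; split; lra.
pose z : C := p1 +i* p2.
have zQ : in_square a b s z.
  rewrite /in_square /=; have := p1P 0%N; have := p2P 0%N.
  by rewrite /t /= expr0 divr1 => -> ->.
have tsmall (d : R) : 0 < d -> exists n, 2 * t n < d.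
  move=> d0; have hn := @upper_nthrootP R (2 * s / d) _ (leqnn _).
  exists (Num.bound (2 * s / d)); rewrite /t mulrA ltr_pdivrMr ?exprn_gt0//.
  by rewrite [d * _]mulrC -ltr_pdivrMr.
have near_z n w : in_square (q n).1 (q n).2 (t n) w -> nm (w - z) <= 2 * t n.
  case: w => u v; rewrite /in_square /= => /andP[uq vq].
  apply: le_trans (ler_modulus_ReIm _) _; rewrite /=.
  have := p1P n; have := p2P n; move: uq vq.
  have hu : `|u - p1| <= t n -> `|v - p2| <= t n -> `|u - p1| + `|v - p2| <= 2 * t n by lra.
  by move=> *; apply: hu; rewrite ler_norml; lra.
have mu2 n : t n ^+ 2 <= mu (q n).1 (q n).2 (t n).
  have tn0 := t0 n.
  have [h1 _] := A1P (q n).1 _ tn0.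
  have [h2 _] := A2P (q n).2 _ tn0.
  rewrite expr2 /mu ler_pM//; lra.
(* At an exceptional point continuity is enough: approximating [f] by a constant gives [e * t n],
   and [mu] is at least [t n] there. *)
have [zE|zE] := boolP (z \in E).
  have e4 : 0 < e / 4 by rewrite divr_gt0.
  have [d d0 fz] := fE zQ zE e4.
  have [n dn] := tsmall _ d0.
  have fq w : in_square (q n).1 (q n).2 (t n) w -> nm (f w - (f z + 0 * w)) <= e / 4.
    move=> wq; rewrite mul0r addr0; apply/ltW/fz/(le_lt_trans _ dn); exact: near_z.
  have := square_affine (t0 n) (qa n).1 (qa n).2 (qb n).1 (qb n).2 fq.
  apply/negP; rewrite -ltNge; apply: le_lt_trans (badq n).
  rewrite (_ : 4 * (e / 4) * t n = e * t n); last by field.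
  rewrite ler_pM2l//.
  have tn0 := t0 n.
  have [_ /(_ p1 _ (p1P n)) h1] := A1P (q n).1 _ tn0.
  have [_ /(_ p2 _ (p2P n)) h2] := A2P (q n).2 _ tn0.
  rewrite -{1}(sqr_sqrtr tn0) expr2 /mu ler_pM ?sqrtr_ge0//.
    by apply: h1; apply/mapP; exists z.
  by apply: h2; apply/mapP; exists z.
(* Elsewhere the affine approximation errs by at most [e / 8 * (2 * t n)], the square lying within
   [2 * t n] of [z]; [square_affine] turns this into [e * t n ^+ 2]. *)
have [l /cdiffP/(_ (e / 8)) h] := fD zQ zE.
have e8 : 0 < e / 8 by rewrite divr_gt0.
have [d d0 fz] := h e8.
have [n dn] := tsmall _ d0.
have fq w : in_square (q n).1 (q n).2 (t n) w ->
    nm (f w - (f z - l * z + l * w)) <= e / 8 * (2 * t n).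
  move=> wq; have wz := near_z _ _ wq.
  rewrite (_ : _ - _ = f w - f z - l * (w - z)); last by ring.
  apply: le_trans (fz _ (le_lt_trans wz dn)) _.
  by rewrite ler_pM2l//; lra.
have := square_affine (t0 n) (qa n).1 (qa n).2 (qb n).1 (qb n).2 fq.
apply/negP; rewrite -ltNge; apply: le_lt_trans (badq n).
rewrite (_ : 4 * (e / 8 * (2 * t n)) * t n = e * t n ^+ 2); last by field.
by rewrite ler_pM2l.
Qed.

End squares.

(** The retraction of the line onto [[a, a + s]]; applied to both coordinates it extends functions
    continuously from a square to the plane. *)
Definition clamp (a s x : R) := Num.max a (Num.min (a + s) x).

Lemma clamp_id a s x : a <= x <= a + s -> clamp a s x = x.
Proof. by move=> /andP[ax xs]; rewrite /clamp min_r// max_r. Qed.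

Lemma clamp_itv a s x : 0 <= s -> a <= clamp a s x <= a + s.
Proof. by move=> s0; rewrite /clamp le_max lexx ge_max lerDl s0 ge_min lexx. Qed.

Lemma clamp_dist a s x y : `|clamp a s x - clamp a s y| <= `|x - y|.
Proof.
have hmin (c u v : R) : u <= v -> Num.min c u <= Num.min c v <= Num.min c u + (v - u).
  by case: (leP c u) => ?; case: (leP c v) => ? ?; lra.
have hmax (c u v : R) : u <= v -> Num.max c u <= Num.max c v <= Num.max c u + (v - u).
  by case: (leP c u) => ?; case: (leP c v) => ? ?; lra.
have h u v : u <= v -> clamp a s u <= clamp a s v <= clamp a s u + (v - u).
  move=> /(hmin (a + s)) /andP[h1 h2]; have /andP[h3 h4] := hmax a _ _ h1.
  by rewrite /clamp; lra.
have [/h|/ltW/h] := leP x y; rewrite distrC ?[`|x - y|]distrC => /andP[h1 h2].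
  by rewrite !ger0_norm; lra.
by rewrite distrC [`|y - x|]distrC !ger0_norm; lra.
Qed.

(* On the boundary, the sign conditions say that the tangential component of
   the conjugate of [f] is positive. *)
Lemma goursat_sign (f : C -> C) (a b s : R) (E : seq C) : 0 < s ->
  (forall z, in_square a b s z -> ccont f z) ->
  (forall z, in_square a b s z -> z \notin E -> exists l, cdiff f z l) ->
  (forall x, a <= x <= a + s -> 0 < Re (f (x +i* b))) ->
  (forall x, a <= x <= a + s -> Re (f (x +i* (b + s))) < 0) ->
  (forall y, b <= y <= b + s -> Im (f ((a + s) +i* y)) < 0) ->
  (forall y, b <= y <= b + s -> 0 < Im (f (a +i* y))) -> False.
Proof.
move=> s_gt0 fc fd bot top right left; have s0 := ltW s_gt0.
have contR (g : R -> R) : (forall x e, 0 < e -> exists2 d, 0 < d &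
    forall y, `|y - x| < d -> `|g y - g x| < e) -> continuous g.
  move=> h x; apply/cvgrPdist_lt => e e0; have [d d0 dP] := h x e e0.
  apply/nbhs_ballP; exists d => // y xy.
  by rewrite distrC dP// distrC; exact: xy.
have contF x y e : 0 < e -> exists2 d, 0 < d & forall u v, `|u - x| < d -> `|v - y| < d ->
    nm (f (clamp a s u +i* clamp b s v) - f (clamp a s x +i* clamp b s y)) < e.
  move=> e0; have [|d d0 dP] := fc (clamp a s x +i* clamp b s y) _ e e0.
    by rewrite /in_square !clamp_itv.
  exists (d / 2) => [|u v ux vy]; first lra.
  apply: dP; apply: le_lt_trans (ler_modulus_ReIm _) _; rewrite /=.
  have := clamp_dist a s u x; have := clamp_dist b s v y; lra.
(* The base point [a - 1] lies strictly to the left of the square, so that the primitive has a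
   two-sided derivative at the end [a] too. *)
have exH y : exists G : R -> R, forall x, a - 1 < x ->
    is_derive x 1 G (Re (f (clamp a s x +i* clamp b s y))).
  apply: primitive_exists; apply: contR => x e e0.
  have [d d0 dP] := contF x y e e0; exists d => // u ux.
  rewrite -raddfB; apply: le_lt_trans (ler_Re_modulus _) _.
  by apply: dP => //; rewrite subrr normr0.
have exV x : exists G : R -> R, forall y, b - 1 < y ->
    is_derive y 1 G (Im (f (clamp a s x +i* clamp b s y))).
  apply: primitive_exists; apply: contR => y e e0.
  have [d d0 dP] := contF x y e e0; exists d => // u ux.
  rewrite -raddfB; apply: le_lt_trans (ler_Im_modulus _) _.
  by apply: dP => //; rewrite subrr normr0.
have [PH PHP] := choice exH; have [PV PVP] := choice exV.
have dPH x y : a <= x <= a + s -> b <= y <= b + s -> is_derive x 1 (PH y) (Re (f (x +i* y))).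
  move=> xa yb; rewrite -{2}(clamp_id xa) -{2}(clamp_id yb); apply: PHP; lra.
have dPV x y : a <= x <= a + s -> b <= y <= b + s -> is_derive y 1 (PV x) (Im (f (x +i* y))).
  move=> xa yb; rewrite -{2}(clamp_id xa) -{2}(clamp_id yb); apply: PVP; lra.
have := goursat s0 dPH dPV (fun z zQ _ => fc z zQ) fd.
have aas : a <= a + s by lra.
have bbs : b <= b + s by lra.
have aa : a <= a <= a + s by lra.
have bb : b <= b <= b + s by lra.
have as_ : a <= a + s <= a + s by lra.
have bs_ : b <= b + s <= b + s by lra.
(* Each side integral is [s] times a value of [Re f] or [Im f] on that side; with the signs that
   they carry in the boundary integral, all four terms are positive. *)
have [x1 x1a ->] := MVT_le aas (fun x xa => dPH x b xa bb).
have [x2 x2a ->] := MVT_le aas (fun x xa => dPH x (b + s) xa bs_).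
have [y1 y1b ->] := MVT_le bbs (fun y yb => dPV (a + s) y as_ yb).
have [y2 y2b ->] := MVT_le bbs (fun y yb => dPV a y aa yb).
have := bot _ x1a; have := top _ x2a; have := right _ y1b; have := left _ y2b.
move: (Re _) (Re _) (Im _) (Im _) => r1 r2 r3 r4.
rewrite ![_ + s - _]addrAC !subrr !add0r -!mulrBl -mulrDl => h1 h2 h3 h4 /eqP.
by rewrite mulf_eq0 => /orP[] /eqP; lra.
Qed.

Lemma cdiffX (f : C -> C) z l n : cdiff f z l -> exists m, cdiff (fun w => f w ^+ n) z m.
Proof.
move=> fl; elim: n => [|n [m IH]]; first by exists 0; exact: cdiff_cst.
have := cdiffM fl IH; set k := (X in cdiff _ _ X) => h.
exists k; rewrite (_ : (fun _ => _) = (fun w => f w * f w ^+ n))//.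
by apply/funext => w; rewrite exprS.
Qed.

Lemma ccontX (f : C -> C) z n : ccont f z -> ccont (fun w => f w ^+ n) z.
Proof.
move=> fz; elim: n => [|n IH]; first exact: ccont_cst.
rewrite (_ : (fun _ => _) = (fun w => f w * f w ^+ n)); first exact: ccontM.
by apply/funext => w; rewrite exprS.
Qed.

Definition slope (f : C -> C) (z l w : C) : C :=
  if w == z then l else (f w - f z) / (w - z).

Lemma slope_cont (f : C -> C) (z l : C) : cdiff f z l -> ccont (slope f z l) z.
Proof.
move=> [q qc [qz fq]]; rewrite (_ : slope f z l = q)//.
apply/funext => w; rewrite /slope; case: eqVneq => [->//|wz].
by rewrite fq addrC addKr mulfK// subr_eq0.
Qed.

Lemma slope_near (f : C -> C) (z l v : C) : v != z -> exists2 d : R, 0 < d &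
  forall w, nm (w - v) < d -> (f w - f z) / (w - z) = slope f z l w.
Proof.
move=> vz; exists (nm (v - z)); first by rewrite modulus_gt0 subr_eq0.
move=> w wv; rewrite /slope; case: eqVneq wv => // ->.
by rewrite modulusB ltxx.
Qed.

Lemma eq_ccont (f g : C -> C) z :
  (exists2 d : R, 0 < d & forall w, nm (w - z) < d -> f w = g w) -> ccont f z -> ccont g z.
Proof.
move=> [d d0 fg] fz e e0; have [d' d'0 h] := fz e e0.
exists (Num.min d d') => [|w]; first by rewrite lt_min d0.
by rewrite lt_min => /andP[wd /h]; rewrite !fg// subrr modulus0.
Qed.

Lemma eq_cdiff (f g : C -> C) z l :
  (exists2 d : R, 0 < d & forall w, nm (w - z) < d -> f w = g w) -> cdiff f z l -> cdiff g z l.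
Proof.
move=> [d d0 fg] /cdiffP fz; apply/cdiffP => e e0; have [d' d'0 h] := fz e e0.
exists (Num.min d d') => [|w]; first by rewrite lt_min d0.
by rewrite lt_min => /andP[wd /h]; rewrite !fg// subrr modulus0.
Qed.

Lemma slope_diff (f : C -> C) (z l v m : C) : v != z -> cdiff f v m -> exists k, cdiff (slope f z l) v k.
Proof.
move=> vz fv; have vz0 : v - z != 0 by rewrite subr_eq0.
have [k hk] := cdiffV (f := fun w => w - z) vz0 (cdiffD (cdiff_id v) (cdiff_cst (- z) v)).
have hh := cdiffM (cdiffD fv (cdiff_cst (- f z) v)) hk.
eexists; exact: eq_cdiff (slope_near f l vz) hh.
Qed.

(** Real coordinates of the rotated difference quotient: the first one matters on horizontal sides,
    the second one on vertical sides. *)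
Lemma rot_div (p q u v : R) : u ^+ 2 + v ^+ 2 != 0 ->
  'i * ((p +i* q) / (u +i* v)) =
  ((p * v - q * u) / (u ^+ 2 + v ^+ 2)) +i* ((p * u + q * v) / (u ^+ 2 + v ^+ 2)).
Proof.
move=> uv; apply/eqP; rewrite eq_complex /=; apply/andP.
by split; apply/eqP; field.
Qed.

Lemma ReIm_gt0 (z : C) : z != 0 -> 0 < Re z ^+ 2 + Im z ^+ 2.
Proof.
move=> z0; rewrite lt0r addr_ge0 ?sqr_ge0// andbT; apply: contra z0.
by rewrite paddr_eq0 ?sqr_ge0// !sqrf_eq0 eq_complex.
Qed.

Definition on_boundary (a b s : R) (w : C) :=
  in_square a b s w && [|| Re w == a, Re w == a + s, Im w == b | Im w == b + s].

(* Were [f z] larger, the tangential component of the rotated difference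
   quotient [i c (f w - f z) / (w - z)] would be positive along the whole
   boundary, against [goursat_sign]. *)
Lemma cauchy_bound (f : C -> C) (a b s d : R) (E : seq C) (z : C) (M : R) :
  0 < d -> 0 <= M -> a + d <= Re z <= a + s - d -> b + d <= Im z <= b + s - d ->
  (forall w, in_square a b s w -> ccont f w) ->
  (forall w, in_square a b s w -> w \notin E -> exists l, cdiff f w l) ->
  z \notin E -> (forall w, on_boundary a b s w -> nm (f w) <= M) ->
  nm (f z) <= 2 * s / d * M.
Proof.
move=> d0 M0 za zb fc fd zE fM; rewrite leNgt; apply/negP => big.
have s0 : 0 < s by lra.
have zQ : in_square a b s z by rewrite /in_square; lra.
have [l fl] := fd z zQ zE.
have fz0 : 0 < nm (f z) by apply: le_lt_trans big; rewrite !mulr_ge0 ?invr_ge0//; lra.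
pose c := (nm (f z))%:C / f z.
have fz_neq0 : f z != 0 by rewrite -modulus_gt0.
have cf : c * f z = (nm (f z))%:C by rewrite /c mulfVK.
have nc : nm c = 1.
  rewrite /c modulusM modulusV modulus_real ger0_norm ?modulus_ge0// mulfV//.
  by rewrite modulus_eq0.
pose g w := 'i * (c * slope f z l w).
(* [dd] is the distance from [z] to a side, [u] the offset along it, and [p +i* q] stands for
   [c * f w]. The assumed size of [f z] outweighs the two error terms, each at most [M * s]. *)
have key (p q u dd : R) : `|p| <= M -> `|q| <= M -> `|u| <= s -> d <= dd <= s ->
    0 < nm (f z) * dd - p * dd - q * u.
  move=> pM qM us dds.
  have h1 : q * u <= M * s.
    by apply: le_trans (ler_norm _) _; rewrite normrM ler_pM.
  have h2 : p * dd <= M * s.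
    apply: le_trans (ler_norm _) _; rewrite normrM ler_pM//.
    rewrite ger0_norm; lra.
  have h3 : nm (f z) * d <= nm (f z) * dd by rewrite ler_pM2l//; lra.
  move: big; rewrite mulrAC ltr_pdivrMr//; lra.
have gE w : in_square a b s w -> w != z -> nm (f w) <= M -> exists p q N : R,
  [/\ `|p| <= M, `|q| <= M, 0 < N &
    g w = (((p - nm (f z)) * (Im w - Im z) - q * (Re w - Re z)) / N) +i*
          (((p - nm (f z)) * (Re w - Re z) + q * (Im w - Im z)) / N)].
  move=> wQ wz fw; rewrite -!raddfB; exists (Re (c * f w)), (Im (c * f w)), (Re (w - z) ^+ 2 + Im (w - z) ^+ 2).
  have N0 : 0 < Re (w - z) ^+ 2 + Im (w - z) ^+ 2.
    by apply: ReIm_gt0; rewrite subr_eq0.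
  split=> //.
  - by apply: le_trans (ler_Re_modulus _) _; rewrite modulusM nc mul1r.
  - by apply: le_trans (ler_Im_modulus _) _; rewrite modulusM nc mul1r.
  rewrite /g /slope (negbTE wz) mulrA mulrBr cf.
  rewrite (_ : c * f w - _ = (Re (c * f w) - nm (f z)) +i* Im (c * f w)); last first.
    by case: (c * f w) => ? ? /=; apply/eqP; rewrite eq_complex /= oppr0 addr0 !eqxx.
  rewrite {1}(_ : w - z = Re (w - z) +i* Im (w - z)); last by case: (w - z).
  by rewrite rot_div// gt_eqF.
(* [z] joins the exceptional points, as the quotient is only known to be continuous there. *)
apply: (@goursat_sign g a b s (z :: E) s0).
- move=> w wQ; apply: ccontM; first exact: ccont_cst.
  apply: ccontM; first exact: ccont_cst.
  have [->|wz] := eqVneq w z; first exact: slope_cont.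
  have wz0 : w - z != 0 by rewrite subr_eq0.
  have h : ccont (fun w => (f w - f z) / (w - z)) w.
    apply: ccontM; first by apply: ccontD; [exact: fc|exact: ccont_cst].
    apply: ccontV => //; apply: ccontD; [exact: ccont_id|exact: ccont_cst].
  exact: eq_ccont (slope_near f l wz) h.
- move=> w wQ; rewrite inE negb_or => /andP[wz wE].
  have [m fm] := fd w wQ wE; have [k hk] := slope_diff l wz fm.
  by eexists; apply: (cdiffM (cdiff_cst _ _) (cdiffM (cdiff_cst _ _) hk)).
- move=> x xa; have wQ : in_square a b s (x +i* b) by rewrite /in_square /=; lra.
  have wb : on_boundary a b s (x +i* b) by rewrite /on_boundary wQ /= eqxx !orbT.
  have wz : x +i* b != z.
    by apply/eqP => h; move: zb; rewrite -h /=; lra.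
  have [p [q [N [pM qM N0 ->]]]] := gE _ wQ wz (fM _ wb).
  rewrite /= divr_gt0//.
  have us : `|x - Re z| <= s by rewrite ler_norml; lra.
  have dd : d <= Im z - b <= s by lra.
  have := key p q (x - Re z) (Im z - b) pM qM us dd; lra.
- move=> x xa; have wQ : in_square a b s (x +i* (b + s)) by rewrite /in_square /=; lra.
  have wb : on_boundary a b s (x +i* (b + s)) by rewrite /on_boundary wQ /= eqxx !orbT.
  have wz : x +i* (b + s) != z.
    by apply/eqP => h; move: zb; rewrite -h /=; lra.
  have [p [q [N [pM qM N0 ->]]]] := gE _ wQ wz (fM _ wb).
  rewrite /= pmulr_llt0 ?invr_gt0//.
  have us : `|Re z - x| <= s by rewrite ler_norml; lra.
  have dd : d <= b + s - Im z <= s by lra.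
  have := key p q (Re z - x) (b + s - Im z) pM qM us dd; lra.
- move=> y yb; have wQ : in_square a b s ((a + s) +i* y) by rewrite /in_square /=; lra.
  have wb : on_boundary a b s ((a + s) +i* y) by rewrite /on_boundary wQ /= eqxx !orbT.
  have wz : (a + s) +i* y != z.
    by apply/eqP => h; move: za; rewrite -h /=; lra.
  have [p [q [N [pM qM N0 ->]]]] := gE _ wQ wz (fM _ wb).
  rewrite /= pmulr_llt0 ?invr_gt0//.
  have us : `|y - Im z| <= s by rewrite ler_norml; lra.
  have dd : d <= a + s - Re z <= s by lra.
  have := key p q (y - Im z) (a + s - Re z) pM qM us dd; lra.
- move=> y yb; have wQ : in_square a b s (a +i* y) by rewrite /in_square /=; lra.
  have wb : on_boundary a b s (a +i* y) by rewrite /on_boundary wQ /= eqxx.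
  have wz : a +i* y != z.
    by apply/eqP => h; move: za; rewrite -h /=; lra.
  have [p [q [N [pM qM N0 ->]]]] := gE _ wQ wz (fM _ wb).
  rewrite /= divr_gt0//.
  have us : `|Im z - y| <= s by rewrite ler_norml; lra.
  have dd : d <= Re z - a <= s by lra.
  have := key p q (Im z - y) (Re z - a) pM qM us dd; lra.
Qed.

End Goursat.

(** * Maximum principle and Weierstrass' theorem *)

Section MaximumPrinciple.
Context {R : realType}.
Local Notation C := R[i].

(** Bernoulli's inequality and the Archimedean property. *)
Lemma pow_unbounded (r K : R) : 1 < r -> exists n : nat, K < r ^+ n.
Proof.
move=> r1; have ber n : 1 + n%:R * (r - 1) <= r ^+ n.
  elim: n => [|n IH]; first by rewrite mul0r addr0 expr0.
  have rn : 1 <= r ^+ n by rewrite exprn_ege1// ltW.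
  rewrite exprS -natr1; move: (n%:R) IH rn => x IH rn.
  have : (r - 1) * 1 <= (r - 1) * r ^+ n by rewrite ler_pM2l//; lra.
  lra.
have [K0|K0] := leP 0 K; last by exists 0%N; rewrite expr0; lra.
have h : 0 <= K / (r - 1) by rewrite divr_ge0//; lra.
exists (Num.bound (K / (r - 1))).
apply: lt_le_trans (ber _).
have := archi_boundP h; rewrite ltr_pdivrMr; lra.
Qed.

(* Landau's trick: [cauchy_bound] for all powers of [f]. *)
Lemma max_square (f : C -> C) (a b s : R) (E : seq C) (z : C) (M : R) :
  0 <= M -> a < Re z < a + s -> b < Im z < b + s ->
  (forall w, in_square a b s w -> ccont f w) ->
  (forall w, in_square a b s w -> w \notin E -> exists l, cdiff f w l) ->
  z \notin E -> (forall w, on_boundary a b s w -> nm (f w) <= M) -> nm (f z) <= M.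
Proof.
move=> M0 za zb fc fd zE fM.
pose d := Num.min (Num.min (Re z - a) (a + s - Re z)) (Num.min (Im z - b) (b + s - Im z)).
have d0 : 0 < d by rewrite !lt_min; lra.
have [d1 d2] : d <= Re z - a /\ d <= a + s - Re z by rewrite /d !ge_min !lexx ?orbT.
have [d3 d4] : d <= Im z - b /\ d <= b + s - Im z by rewrite /d !ge_min !lexx ?orbT.
have bound n : nm (f z) ^+ n <= 2 * s / d * M ^+ n.
  rewrite -modulusX; apply: (@cauchy_bound _ (fun w => f w ^+ n) a b s d E) => //.
  - by rewrite exprn_ge0.
  - lra.
  - lra.
  - by move=> w /fc; exact: ccontX.
  - by move=> w wQ wE; have [l fl] := fd w wQ wE; exact: cdiffX fl.
  - by move=> w /fM; rewrite modulusX => h; rewrite lerXn2r// nnegrE modulus_ge0.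
rewrite leNgt; apply/negP => Mf.
have [M1|M1] := eqVneq M 0.
  by have := bound 1%N; rewrite !expr1 M1 mulr0; lra.
have {M1}M0' : 0 < M by rewrite lt0r M1.
have r1 : 1 < nm (f z) / M by rewrite ltr_pdivlMr// mul1r.
have [n] := pow_unbounded (2 * s / d) r1; apply/negP; rewrite -leNgt.
by rewrite expr_div_n ler_pdivrMr ?exprn_gt0.
Qed.

Definition holo (f : C -> C) z := exists l, cdiff f z l.

(* The maximum principle for the difference quotient, exceptional point [z]. *)
Lemma holo_slope (f : C -> C) (z : C) (r N : R) : 0 < r ->
  (forall w, nm (w - z) <= 2 * r -> holo f w) ->
  (forall w, nm (w - z) <= 2 * r -> nm (f w - f z) <= N) ->
  forall w, nm (w - z) < r -> nm (f w - f z) <= N / r * nm (w - z).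
Proof.
move=> r0 fh fN w wr.
have N0 : 0 <= N.
  by have := fN z; rewrite !subrr modulus0; apply; lra.
have [->|wz] := eqVneq w z; first by rewrite !subrr modulus0 mulr0.
have [|l fl] := fh z; first by rewrite subrr modulus0; lra.
(* The square of centre [z] and side [2 * r] contains the disc of radius [r] and lies in the disc of
   radius [2 * r]; its boundary is at distance at least [r] from [z], whence the bound [N / r]
   there. *)
have sq v : in_square (Re z - r) (Im z - r) (2 * r) v -> nm (v - z) <= 2 * r.
  move=> /andP[h1 h2]; apply: le_trans (ler_modulus_ReIm _) _.
  have h3 : `|Re (v - z)| <= r by rewrite raddfB /= ler_norml; lra.
  have h4 : `|Im (v - z)| <= r by rewrite raddfB /= ler_norml; lra.
  lra.
suff : nm (slope f z l w) <= N / r.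
  by rewrite /slope (negbTE wz) modulusM modulusV ler_pdivrMr// modulus_gt0 subr_eq0.
have /ltr_normlP[] : `|Re (w - z)| < r by apply: le_lt_trans (ler_Re_modulus _) wr.
have /ltr_normlP[] : `|Im (w - z)| < r by apply: le_lt_trans (ler_Im_modulus _) wr.
rewrite !raddfB /= => h1 h2 h3 h4.
apply: (@max_square _ (Re z - r) (Im z - r) (2 * r) [:: z]).
- by rewrite divr_ge0// ltW.
- lra.
- lra.
- move=> v /sq vz; have [->|v_z] := eqVneq v z; first exact: slope_cont.
  have [m fm] := fh _ vz; have [k hk] := slope_diff l v_z fm; exact: cdiff_cont hk.
- move=> v /sq vz; rewrite inE => v_z.
  by have [m fm] := fh _ vz; exact: slope_diff fm.
- by rewrite inE.
- move=> v /andP[vQ vb]; have vz := sq _ vQ; have v_r : r <= nm (v - z).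
    case/or4P : vb => /eqP h.
    + apply: le_trans (ler_Re_modulus _); rewrite raddfB /= h ler_normr; lra.
    + apply: le_trans (ler_Re_modulus _); rewrite raddfB /= h ler_normr; lra.
    + apply: le_trans (ler_Im_modulus _); rewrite raddfB /= h ler_normr; lra.
    + apply: le_trans (ler_Im_modulus _); rewrite raddfB /= h ler_normr; lra.
  rewrite /slope; case: eqVneq v_r => [->|v_z v_r]; first by rewrite subrr modulus0; lra.
  rewrite modulusM modulusV ler_pM ?invr_ge0 ?modulus_ge0 ?fN//.
  by rewrite lef_pV2// posrE; lra.
Qed.

Lemma holo_lipschitz (f : C -> C) (z : C) (r M : R) : 0 < r ->
  (forall w, nm (w - z) <= 2 * r -> holo f w) ->
  (forall w, nm (w - z) <= 2 * r -> nm (f w) <= M) ->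
  forall w, nm (w - z) < r -> nm (f w - f z) <= 2 * M / r * nm (w - z).
Proof.
move=> r0 fh fM; apply: holo_slope => // w wz.
apply: le_trans (ler_modulusB _ _) _.
have := fM w wz; have := fM z; rewrite subrr modulus0 => h; have := h _; lra.
Qed.

Lemma cdiff_slope_le (f : C -> C) z l (r K : R) : 0 < r -> cdiff f z l ->
  (forall w, nm (w - z) < r -> nm (f w - f z) <= K * nm (w - z)) -> nm l <= K.
Proof.
move=> r0 /cdiffP fl fK; apply/ler_addgt0Pl => e e0.
have [d d0 dP] := fl _ e0; pose t := Num.min r d / 2.
have t0 : 0 < t by rewrite divr_gt0// lt_min r0.
have [tr td] : t < r /\ t < d.
  have : Num.min r d <= r by rewrite ge_min lexx.
  have : Num.min r d <= d by rewrite ge_min lexx orbT.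
  by rewrite /t; lra.
have nt : nm (z + t%:C - z) = t by rewrite addrC addKr modulus_real ger0_norm// ltW.
have h1 := fK (z + t%:C); have h2 := dP (z + t%:C).
rewrite nt in h1 h2; have {}h1 := h1 tr; have {}h2 := h2 td.
rewrite -(ler_pM2r t0) -{1}nt -modulusM.
have -> : l * (z + t%:C - z) = (f (z + t%:C) - f z) - (f (z + t%:C) - f z - l * (z + t%:C - z)).
  by ring.
apply: le_trans (ler_modulusB _ _) _; lra.
Qed.

(** Weierstrass' theorem. The Lipschitz bound for differences of approximations shows that their
    derivatives at [z] form a Cauchy family; the limit is the derivative of [f], because [f] differs
    from the approximation of accuracy [e] by a function whose increments from [z] are at most
    [K * e * nm (w - z)]. *)
Lemma holo_limit (f : C -> C) (z : C) (r : R) : 0 < r ->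
  (forall e : R, 0 < e -> exists2 g : C -> C,
    (forall w, nm (w - z) <= 2 * r -> holo g w) &
    (forall w, nm (w - z) <= 2 * r -> nm (g w - f w) <= e)) ->
  holo f z.
Proof.
move=> r0 app; pose K := 2 / r; have K0 : 0 < K by rewrite divr_gt0.
have zz : nm (z - z) <= 2 * r by rewrite subrr modulus0; lra.
have app' (e : R) : exists gl : (C -> C) * C, 0 < e ->
    [/\ forall w, nm (w - z) <= 2 * r -> holo gl.1 w,
        forall w, nm (w - z) <= 2 * r -> nm (gl.1 w - f w) <= e & cdiff gl.1 z gl.2].
  have [e0|] := ltP 0 e; last by exists (id, 0); lra.
  by have [g gh gf] := app e e0; have [l gl] := gh _ zz; exists (g, l).
have [gl glP] := choice app'.
have cmp (e e' : R) w : 0 < e -> 0 < e' -> nm (w - z) < r ->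
    nm ((gl e).1 w - (gl e').1 w - ((gl e).1 z - (gl e').1 z)) <= K * (e + e') * nm (w - z).
  move=> e0 e'0 wr; have [h1 h2 _] := glP _ e0; have [h1' h2' _] := glP _ e'0.
  have := @holo_lipschitz (fun w => (gl e).1 w - (gl e').1 w) z r (e + e') r0 _ _ w wr.
  rewrite /K (_ : 2 * (e + e') / r = 2 / r * (e + e')); last by rewrite mulrAC.
  apply=> v vz.
    have [m hm] := h1 v vz; have [m' hm'] := h1' v vz.
    by eexists; exact: cdiffD hm (cdiffN hm').
  rewrite (_ : _ - _ = ((gl e).1 v - f v) - ((gl e').1 v - f v)); last by ring.
  by apply: le_trans (ler_modulusB _ _) _; apply: lerD; [exact: h2|exact: h2'].
have cmpl (e e' : R) : 0 < e -> 0 < e' -> nm ((gl e).2 - (gl e').2) <= K * (e + e').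
  move=> e0 e'0; have [_ _ h] := glP _ e0; have [_ _ h'] := glP _ e'0.
  apply: (cdiff_slope_le r0 (cdiffD h (cdiffN h'))) => w wr; exact: cmp.
have cmpf (e : R) w : 0 < e -> nm (w - z) < r ->
    nm ((gl e).1 w - f w - ((gl e).1 z - f z)) <= K * e * nm (w - z).
  move=> e0 wr; apply/ler_addgt0Pl => t t0; have wr2 : nm (w - z) <= 2 * r by lra.
  (* Replacing [f] by a second approximation of accuracy [e'] costs [2 * e'] plus
     [K * e' * nm (w - z)], which is exactly [t]. *)
  pose e' := t / (2 + K * nm (w - z)).
  have D0 : 0 < 2 + K * nm (w - z) by rewrite ltr_pwDl// mulr_ge0 ?modulus_ge0// ltW.
  have e'0 : 0 < e' by rewrite divr_gt0.
  have [_ h _] := glP _ e'0; have := cmp e e' w e0 e'0 wr.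
  have := h _ zz; have := h _ wr2.
  rewrite (_ : (gl e).1 w - f w - _ = ((gl e).1 w - (gl e').1 w - ((gl e).1 z - (gl e').1 z))
     + (((gl e').1 w - f w) - ((gl e').1 z - f z))); last by ring.
  move=> h1 h2 h3; apply: le_trans (ler_modulusD _ _) _.
  have h4 := ler_modulusB ((gl e').1 w - f w) ((gl e').1 z - f z).
  have te : t = e' * (2 + K * nm (w - z)) by rewrite /e' divfK// gt_eqF.
  rewrite te; lra.
(* The limit of the derivatives is taken for [P = Re] and [P = Im] separately, as the supremum of
   the lower bounds [P (gl e).2 - K * e]. *)
have lim (P : C -> R) : (forall u v, P u - P v <= nm (u - v)) ->
    exists L, forall e : R, 0 < e -> `|P (gl e).2 - L| <= K * e.
  move=> PP; pose S := [set x | exists2 e, 0 < e & x = P (gl e).2 - K * e].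
  have ub e : 0 < e -> ubound S (P (gl e).2 + K * e).
    move=> e0 _ [e' e'0 ->]; have := PP (gl e').2 (gl e).2; have := cmpl e' e e'0 e0; lra.
  have S0 : S !=set0 by exists (P (gl 1).2 - K * 1); exists 1.
  exists (sup S) => e e0; rewrite ler_norml; apply/andP; split.
    by have := ge_sup S0 (ub e e0); lra.
  suff : P (gl e).2 - K * e <= sup S by lra.
  by apply: ub_le_sup; [exists (P (gl 1).2 + K * 1); exact: ub|exists e].
have [|L1 hL1] := lim (@complex.Re R).
  by move=> u v; rewrite -raddfB; apply: le_trans (ler_norm _) (ler_Re_modulus _).
have [|L2 hL2] := lim (@complex.Im R).
  by move=> u v; rewrite -raddfB; apply: le_trans (ler_norm _) (ler_Im_modulus _).
pose L := L1 +i* L2.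
have hL (e : R) : 0 < e -> nm ((gl e).2 - L) <= 2 * K * e.
  move=> e0; apply: le_trans (ler_modulus_ReIm _) _; rewrite !raddfB /=.
  have := hL1 _ e0; have := hL2 _ e0; lra.
(* The three errors are [e] for the approximation, [K * e] for its difference from [f] and
   [2 * K * e] for its derivative. *)
exists L; apply/cdiffP => t t0; pose e := t / (1 + 3 * K).
have e0 : 0 < e by rewrite divr_gt0//; lra.
have [_ _ /cdiffP/(_ _ e0)[d d0 dP]] := glP _ e0.
exists (Num.min r d) => [|w]; first by rewrite lt_min r0.
rewrite lt_min => /andP[wr /dP h1]; have h2 := cmpf e w e0 wr; have h3 := hL e e0.
have h4 := modulus_ge0 (w - z).
rewrite (_ : f w - f z - _ = ((gl e).1 w - (gl e).1 z - (gl e).2 * (w - z)) -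
  ((gl e).1 w - f w - ((gl e).1 z - f z)) + ((gl e).2 - L) * (w - z)); last by ring.
apply: le_trans (ler_modulusD _ _) _; rewrite modulusM.
have h5 := ler_modulusB ((gl e).1 w - (gl e).1 z - (gl e).2 * (w - z)) ((gl e).1 w - f w - ((gl e).1 z - f z)).
have h6 : nm ((gl e).2 - L) * nm (w - z) <= 2 * K * e * nm (w - z) by rewrite ler_wpM2r.
have te : t = e * (1 + 3 * K) by rewrite /e divfK// gt_eqF//; lra.
rewrite te; lra.
Qed.

End MaximumPrinciple.

(** * Compact subsets of the plane and locally uniform convergence *)

Section PlaneTopology.
Context {R : realType}.
Local Notation C := R[i].
Implicit Types (K D : set R[i]^o).

Lemma open_modulusP D : open D ->
  forall z : C, D z -> exists2 r : R, 0 < r & forall w : C, nm (w - z) < r -> D w.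
Proof. by move=> oD z Dz; apply/nbhs_modulusP; exact: open_nbhs_nbhs. Qed.

Lemma modulus_open D : (forall z : C, D z -> exists2 r : R, 0 < r &
  forall w : C, nm (w - z) < r -> D w) -> open D.
Proof.
by move=> h; rewrite openE => z /h hz; rewrite /interior; apply/nbhs_modulusP.
Qed.

Lemma modulus_closed K : (forall z : C, (forall e : R, 0 < e ->
  exists2 w : C, K w & nm (w - z) < e) -> K z) -> closed K.
Proof.
move=> h z cz; apply: h => e e0.
have [|w [Kw we]] := cz [set w : R[i]^o | nm ((w : C) - z) < e].
  by apply/nbhs_modulusP; exists e.
by exists w.
Qed.

(** The set is closed in the continuous image of a compact real square. *)
Lemma closed_bounded_compact K (m : R) : closed K -> (forall z, K z -> nm z <= m) -> compact K.
Proof.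
move=> cK Km; pose h (p : R * R) : R[i]^o := p.1 +i* p.2.
have hc : continuous h.
  move=> [x y]; apply/(@cvg_modulusP _ _ (nbhs (x, y))) => e e0.
  have e2 : 0 < e / 2 by rewrite divr_gt0.
  exists (ball x (e / 2), ball y (e / 2)) => /=.
    by split; apply/nbhs_ballP; exists (e / 2).
  move=> [u v] [/= xu yv]; apply: le_lt_trans (ler_modulus_ReIm _) _; rewrite /=.
  have : `|x - u| < e / 2 by exact: xu.
  have : `|y - v| < e / 2 by exact: yv.
  rewrite (distrC y) (distrC x); lra.
apply: (@subclosed_compact _ _ (h @` (`[- m, m] `*` `[- m, m]))) => //.
  apply: continuous_compact; first exact: continuous_subspaceT.
  by apply: compact_setX; exact: segment_compact.
move=> [x y] Kz; exists (x, y) => //=; have := Km _ Kz.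
have := ler_Re_modulus (x +i* y); have := ler_Im_modulus (x +i* y).
by rewrite /= !in_itv /= -!ler_norml => h1 h2 h3; split; apply: le_trans h3.
Qed.

(** The covering property in filter form; it replaces finite subcovers in all the later uniformity
    arguments. *)
Lemma compact_near K (I : Type) (F : set_system I) (P : I -> C -> Prop) : Filter F ->
  compact K ->
  (forall z : C, K z -> exists2 d : R, 0 < d &
     \forall i \near F, forall w, nm (w - z) < d -> P i w) ->
  \forall i \near F, forall z, K z -> P i z.
Proof.
move=> FF /compact_near_coveringP cK h.
apply: (cK I F (fun i z => P i z)) => z Kz; have [d d0 dP] := h z Kz.
exists ([set w : R[i]^o | nm ((w : C) - z) < d], [set i | forall w, nm (w - z) < d -> P i w]) => /=.
  by split => //; apply/nbhs_modulusP; exists d.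
by move=> [w i] [/= wz]; apply.
Qed.

Lemma near_at_right (P : R -> Prop) :
  (\forall e \near 0^'+, P e) <-> exists2 d : R, 0 < d & forall e, 0 < e < d -> P e.
Proof.
split=> [/nbhs_ballP[d /= d0 h]|[d d0 h]].
  exists d => // e /andP[e0 ed]; apply: h => //.
  by rewrite /ball /= sub0r normrN gtr0_norm.
apply/nbhs_ballP; exists d => // e; rewrite /ball /= sub0r normrN => ed e0.
by apply: h; rewrite e0 -(gtr0_norm e0).
Qed.

Lemma compact_uniform K (P : R -> C -> Prop) : compact K ->
  (forall z : C, K z -> exists2 d : R, 0 < d &
     forall w, nm (w - z) < d -> forall e, 0 < e < d -> P e w) ->
  exists2 d : R, 0 < d & forall e, 0 < e < d -> forall z, K z -> P e z.
Proof.
move=> cK h; apply/near_at_right; apply: compact_near => // z Kz.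
have [d d0 dP] := h z Kz; exists d => //; apply/near_at_right; exists d => // e ed w wz.
exact: dP.
Qed.

Lemma compact_margin K D : open D -> compact K -> K `<=` D ->
  exists2 r : R, 0 < r & forall z : C, K z -> forall w : C, nm (w - z) < r -> D w.
Proof.
move=> oD cK KD.
have [|d d0 dP] := @compact_uniform K (fun e z => forall w, nm (w - z) < e -> D w) cK.
  move=> z /KD/(open_modulusP oD)[r r0 rP]; exists (r / 2) => [|w wz e er v vw].
    by rewrite divr_gt0.
  apply: rP; rewrite (_ : v - z = (v - w) + (w - z)); last by ring.
  apply: le_lt_trans (ler_modulusD _ _) _; lra.
exists (d / 2) => [|z Kz]; first by rewrite divr_gt0.
by apply: dP => //; lra.
Qed.

Lemma compact_bounded K (f : C -> C) : compact K -> (forall z, K z -> ccont f z) ->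
  exists2 m : R, 0 < m & forall z, K z -> nm (f z) <= m.
Proof.
move=> cK fc.
(* A bound is encoded as the inverse of a small [e], so that a uniform radius yields a uniform
   bound. *)
have [|d d0 dP] := @compact_uniform K (fun e z => nm (f z) <= e^-1) cK.
  move=> z Kz; have [d d0 dP] := fc z Kz 1 ltr01.
  have m0 := modulus_ge0 (f z).
  have i0 : 0 < (1 + nm (f z))^-1 by rewrite invr_gt0; lra.
  exists (Num.min d (1 + nm (f z))^-1); first by rewrite lt_min d0.
  move=> w; rewrite lt_min => /andP[/dP wz _] e; rewrite lt_min => /and3P[e0 _ ei].
  have h : 1 + nm (f z) <= e^-1.
    by rewrite -[leLHS]invrK lef_pV2 ?posrE// ltW.
  rewrite -[f w](subrK (f z)); apply: le_trans (ler_modulusD _ _) _; lra.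
exists (d / 2)^-1 => [|z Kz]; first by rewrite invr_gt0 divr_gt0.
by apply: dP => //; lra.
Qed.

Lemma compact_bounded_id K : compact K -> exists2 m : R, 0 < m & forall z, K z -> nm z <= m.
Proof. by move=> cK; apply: (compact_bounded cK) => z _; exact: ccont_id. Qed.

Lemma compact_equicont K (f : C -> C) (e : R) : compact K -> (forall z, K z -> ccont f z) ->
  0 < e -> exists2 d : R, 0 < d &
    forall z w, K z -> nm (w - z) < d -> nm (f w - f z) < e.
Proof.
move=> cK fc e0; have e2 : 0 < e / 2 by rewrite divr_gt0.
have [|d d0 dP] := @compact_uniform K
    (fun d z => forall w, nm (w - z) < d -> nm (f w - f z) < e) cK.
  move=> z Kz; have [d d0 dP] := fc z Kz _ e2; exists (d / 2) => [|w wz t td v vw].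
    by rewrite divr_gt0.
  rewrite (_ : f v - f w = (f v - f z) - (f w - f z)); last by ring.
  apply: le_lt_trans (ler_modulusB _ _) _.
  have h1 : nm (f w - f z) < e / 2 by apply: dP; lra.
  have h2 : nm (f v - f z) < e / 2.
    apply: dP; rewrite (_ : v - z = (v - w) + (w - z)); last by ring.
    apply: le_lt_trans (ler_modulusD _ _) _; lra.
  lra.
exists (d / 2) => [|z w Kz wz]; first by rewrite divr_gt0.
by apply: (dP (d / 2)) => //; lra.
Qed.

Lemma compact_image K (f : C -> C) : compact K -> (forall z, K z -> ccont f z) ->
  compact (f @` K : set R[i]^o).
Proof.
move=> cK fc; apply: (@continuous_compact R[i]^o R[i]^o f) => //.
apply: continuous_in_subspaceT => z; rewrite inE => Kz.
by apply/ccontP; exact: fc.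
Qed.

Lemma compact_fatten K D : open D -> compact K -> K `<=` D ->
  exists2 r : R, 0 < r & exists K1 : set R[i]^o,
    [/\ compact K1, K1 `<=` D & forall z w : C, K z -> nm (w - z) <= r -> K1 w].
Proof.
move=> oD cK KD; have [r r0 rP] := compact_margin oD cK KD.
exists (r / 2); first by rewrite divr_gt0.
(* The points at distance at most [r / 2] from [K]; the slack [e] avoids having to attain that
   distance and makes the set visibly closed. *)
exists [set w | forall e : R, 0 < e -> exists2 z : C, K z & nm ((w : C) - z) < r / 2 + e].
split; last by move=> z w Kz wz e e0; exists z => //; lra.
  have [m m0 mP] := compact_bounded_id cK.
  apply: (@closed_bounded_compact _ (m + r)).
    apply: modulus_closed => z h e e0; have e2 : 0 < e / 2 by rewrite divr_gt0.
    have [w /(_ _ e2)[v Kv wv] zw] := h _ e2; exists v => //.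
    rewrite (_ : z - v = (w - v) - (w - z)); last by ring.
    apply: le_lt_trans (ler_modulusB _ _) _; lra.
  move=> w h; have r2 : 0 < r / 2 by rewrite divr_gt0.
  have [z Kz zw] := h _ r2; rewrite -[w : C](subrK z).
  by apply: le_trans (ler_modulusD _ _) _; have := mP _ Kz; lra.
move=> w h; have r2 : 0 < r / 2 by rewrite divr_gt0.
have [z Kz zw] := h _ r2; apply: (rP _ Kz); lra.
Qed.

Lemma family_cvgP D (T : Type) (F : set_system T) {FF : Filter F}
    (u : T -> R[i]^o -> R[i]^o) (f : R[i]^o -> R[i]^o) :
  {family compactly_in D, u x @[x --> F] --> f} <->
  forall K, compact K -> K `<=` D -> forall e : R, 0 < e ->
    \forall x \near F, forall z : C, K z -> nm ((u x z : C) - f z) < e.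
Proof.
split.
  move=> /fam_cvgP h K cK KD e e0.
  have e0' : (0 : C) < e%:C by rewrite ltcR.
  have : nbhs (f : {uniform` K -> R[i]^o})
      [set g : {uniform` K -> R[i]^o} | forall z : C, K z -> nm ((g z : C) - f z) < e].
    apply/uniform_nbhs; exists [set p | ball p.1 e%:C p.2]; split.
      by rewrite -entourage_ballE; exists e%:C.
    by move=> g /= h' z Kz; apply/ball_modulus/h'.
  exact: (h K (conj KD cK)).
move=> h; apply/fam_cvgP => K [KD cK] A /uniform_nbhs[E [+ EA]].
rewrite -entourage_ballE => -[e /= e0 eE].
have [d d0 ed] := posC_real e0.
have := h K cK KD d d0; apply: filterS => x hx; apply: EA => z Kz.
by apply: eE => /=; rewrite ed; apply/ball_modulus/hx.
Qed.

(** The sets [B (K, e)] generate a filter converging to [f]; hence every neighbourhood of [f]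
    contains one of them, and [V] meets them all. *)
Lemma closed_family_mem D (V : set {family compactly_in D, R[i]^o -> R[i]^o})
    (f : R[i]^o -> R[i]^o) : closed V ->
  (forall K, compact K -> K `<=` D -> forall e : R, 0 < e ->
    exists2 g : R[i]^o -> R[i]^o, V g & forall z : C, K z -> nm ((g z : C) - f z) < e) ->
  V f.
Proof.
move=> cV h; apply: cV.
pose B (p : set R[i]^o * R) := [set g : R[i]^o -> R[i]^o | forall z : C, p.1 z -> nm ((g z : C) - f z) < p.2].
pose F := filter_from [set p : set R[i]^o * R | [/\ compact p.1, p.1 `<=` D & 0 < p.2]] B.
have FF : Filter F.
  apply: filter_from_filter; first by exists (set0, 1); split => //; exact: compact0.
  move=> [K1 e1] [K2 e2] [/= c1 d1 p1] [/= c2 d2 p2].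
  exists (K1 `|` K2, Num.min e1 e2) => [|g /= hg].
    split => /=; [exact: compactU|by move=> z []; [exact: d1|exact: d2]|by rewrite lt_min p1].
  split => z /= Kz.
    by have /(_ (or_introl Kz)) := hg z; rewrite lt_min => /andP[].
  by have /(_ (or_intror Kz)) := hg z; rewrite lt_min => /andP[].
have Ff : {family compactly_in D, u @[u --> F] --> f}.
  apply/(@family_cvgP D _ F FF (fun u => u) f) => K cK KD e e0.
  by exists (K, e) => // g gf z Kz; exact: gf.
move=> W /Ff [[K e] [/= cK KD e0] BW].
have [g Vg gf] := h K cK KD e e0; exists g; split => //.
by apply: BW.
Qed.

Lemma closure_family_mem D (V : set {family compactly_in D, R[i]^o -> R[i]^o})
    (f : {family compactly_in D, R[i]^o -> R[i]^o}) : closure V f ->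
  forall K, compact K -> K `<=` D -> forall e : R, 0 < e ->
    exists2 g : R[i]^o -> R[i]^o, V g & forall z : C, K z -> nm ((g z : C) - f z) < e.
Proof.
move=> cf K cK KD e e0.
have : {family compactly_in D, u @[u --> nbhs f] --> f} by [].
move=> /family_cvgP/(_ K cK KD e e0)/cf[g [Vg gf]]; by exists g.
Qed.

Lemma image_ultra (S T : Type) (F : set_system S) (f : S -> T) :
  UltraFilter F -> UltraFilter (f @ F).
Proof.
move=> FU; split; first exact: fmap_proper_filter.
move=> G GP FG; apply/seteqP; split => // A GA.
have [//|nA] := in_ultra_setVsetC (f @^-1` A) FU.
have : G (A `&` ~` A) by apply: filterI => //; exact: FG.
by rewrite setICr => /filter_not_empty.
Qed.

Lemma ultra_compact_limit (T : Type) (F : set_system T) K (f : T -> C) : UltraFilter F ->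
  compact K -> (\forall x \near F, K (f x)) ->
  exists2 l : C, K l & forall e : R, 0 < e -> \forall x \near F, nm (f x - l) < e.
Proof.
move=> FU cK FK; have FU' := image_ultra (f : T -> R[i]^o) FU.
move: cK; rewrite compact_ultra => /(_ _ FU' FK)[l [Kl fl]].
by exists l => //; apply/cvg_modulusP.
Qed.

End PlaneTopology.

(** * Square roots on simply connected domains *)

Section SquareRoot.
Context {R : realType}.
Local Notation C := R[i].

Lemma right_sqrt : exists ps : C -> C, forall z : C, 0 < Re z -> ps z ^+ 2 = z /\ 0 < Re (ps z).
Proof.
have ex (z : C) : exists s : C, 0 < Re z -> s ^+ 2 = z /\ 0 < Re s.
  have [s0|s0|s0] := ltgtP 0 (Re (sqrtc z)).
  - by exists (sqrtc z); rewrite sqr_sqrtc.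
  - exists (- sqrtc z); rewrite sqrrN sqr_sqrtc; split => //.
    by rewrite raddfN /= oppr_gt0.
  - exists 0 => z0; exfalso; move: z0; rewrite -[z]sqr_sqrtc.
    case: (sqrtc z) s0 => x y /= <-.
    by have := sqr_ge0 y; rewrite expr2; lra.
by have [ps psP] := choice ex; exists ps.
Qed.

(** The principal square root on the right half-plane; its values elsewhere are arbitrary. *)
Definition psqrt : C -> C := projT1 (cid right_sqrt).

Lemma psqrtP (z : C) : 0 < Re z -> psqrt z ^+ 2 = z /\ 0 < Re (psqrt z).
Proof. exact: (projT2 (cid right_sqrt)). Qed.

Lemma near1_Re (z : C) : nm (z - 1) < 1 -> 0 < Re z.
Proof.
have := ler_Re_modulus (z - 1); rewrite raddfB /= => h1 h2.
have /ltr_normlP[] := le_lt_trans h1 h2; lra.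
Qed.

Lemma psqrt1 : psqrt 1 = 1.
Proof.
have [//|h1 h2] := @psqrtP 1; apply/eqP; move: h1 => /eqP.
rewrite sqrf_eq1 => /orP[//|/eqP h]; move: h2; rewrite h raddfN /=; lra.
Qed.

(** In [(psqrt w - psqrt z) * (psqrt w + psqrt z) = w - z] the second factor has modulus at least
    [Re (psqrt z)]. *)
Lemma psqrt_cont (z : C) : 0 < Re z -> ccont psqrt z.
Proof.
move=> z0 e e0; have [h1 h2] := psqrtP z0.
exists (Num.min (Re z) (e * Re (psqrt z))); first by rewrite lt_min z0 mulr_gt0.
move=> w; rewrite lt_min => /andP[wz1 wz2].
have w0 : 0 < Re w.
  have := ler_Re_modulus (w - z); rewrite raddfB /= => h.
  have /ltr_normlP[] := le_lt_trans h wz1; lra.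
have [h3 h4] := psqrtP w0.
have h5 : Re (psqrt z) <= nm (psqrt w + psqrt z).
  apply: le_trans (ler_Re_modulus _); apply: le_trans (ler_norm _).
  by rewrite raddfD /= lerDr ltW.
rewrite -(ltr_pM2r h2); apply: le_lt_trans wz2.
rewrite -[w in leRHS]h3 -[z in leRHS]h1 subr_sqr modulusM.
by rewrite ler_wpM2l ?modulus_ge0.
Qed.

(** The quotient of the two lifts is continuous with values [1] and [-1]; by the intermediate value
    theorem it cannot change sign. *)
Lemma lift_unique (s1 s2 : C -> C) :
  (forall t : R, 0 <= t <= 1 -> ccont s1 t%:C) -> (forall t : R, 0 <= t <= 1 -> ccont s2 t%:C) ->
  (forall t : R, 0 <= t <= 1 -> s1 t%:C ^+ 2 = s2 t%:C ^+ 2) ->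
  (forall t : R, 0 <= t <= 1 -> s2 t%:C != 0) -> s1 0 = s2 0 -> s1 1 = s2 1.
Proof.
move=> c1 c2 s12 s20 e0; pose q (z : C) := s1 z / s2 z.
have qc (t : R) : 0 <= t <= 1 -> ccont q t%:C.
  move=> t01; apply: ccontM; first exact: c1.
  by apply: ccontV; [exact: s20|exact: c2].
have q2 (t : R) : 0 <= t <= 1 -> q t%:C = 1 \/ q t%:C = - 1.
  move=> t01; have /eqP : q t%:C ^+ 2 = 1.
    by rewrite /q expr_div_n s12// divff// sqrf_eq0 s20.
  by rewrite sqrf_eq1 => /orP[] /eqP ->; [left|right].
have z01 : 0 <= (0 : R) <= 1 by rewrite lexx ler01.
have o01 : 0 <= (1 : R) <= 1 by rewrite lexx ler01.
have q0 : q 0 = 1 by rewrite /q e0 divff// s20.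
have [q1|q1] := q2 1 o01.
  by move: q1 => /(congr1 (fun x => x * s2 1)); rewrite /q mul1r mulfVK// s20.
exfalso; have gc : {within `[0 : R, 1], continuous (fun t : R => Re (q t%:C))}.
  apply: continuous_in_subspaceT => t; rewrite inE /= in_itv /= => t01.
  apply/cvgrPdist_lt => e e_gt0; have [d d0 dP] := qc t t01 e e_gt0.
  apply/nbhs_ballP; exists d => // u ut; rewrite -raddfB.
  apply: le_lt_trans (ler_Re_modulus _) _; rewrite modulusB; apply: dP.
  by rewrite -rmorphB modulus_real distrC; exact: ut.
have [|c] := @IVT _ _ 0 1 0 ler01 gc.
  by rewrite q0 (q1 : q (1 : R)%:C = -1) raddfN /= ge_min le_max lerN10 ler01 orbT.
rewrite in_itv /= => c01 qc0; have [h|h] := q2 c c01; move: qc0; rewrite h ?raddfN /=; lra.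
Qed.

Lemma square_compact : compact (in_square 0 0 1 : set R[i]^o).
Proof.
apply: (@closed_bounded_compact _ _ 2).
  apply: modulus_closed => z h.
  have h' (x : R) : (forall e : R, 0 < e -> x <= e) -> x <= 0.
    by move=> xe; apply/ler_addgt0Pl => e e0; rewrite addr0 xe.
  have hh (e : R) : 0 < e -> [/\ - Re z <= e, Re z - 1 <= e, - Im z <= e & Im z - 1 <= e].
    move=> e0; have [w + zw] := h e e0; rewrite /in_square.
    have := le_lt_trans (ler_Re_modulus _) zw; have := le_lt_trans (ler_Im_modulus _) zw.
    by rewrite !raddfB /= => /ltr_normlP[? ?] /ltr_normlP[? ?] /andP[? ?]; split; lra.
  have h1 : - Re z <= 0 by apply: h' => e /hh[].
  have h2 : Re z - 1 <= 0 by apply: h' => e /hh[].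
  have h3 : - Im z <= 0 by apply: h' => e /hh[].
  have h4 : Im z - 1 <= 0 by apply: h' => e /hh[].
  rewrite /in_square; lra.
move=> z /andP[h1 h2]; apply: le_trans (ler_modulus_ReIm _) _.
have : `|Re z| <= 1 by rewrite ler_norml; lra.
have : `|Im z| <= 1 by rewrite ler_norml; lra.
lra.
Qed.

(* Telescoping along rays: [h z = h 0 * prod_j h ((j+1)z/n) / h (jz/n)], each
   factor being close to one for [n] large. *)
Lemma square_lift (h : C -> C) :
  (forall z, in_square 0 0 1 z -> ccont h z) -> (forall z, in_square 0 0 1 z -> h z != 0) ->
  exists s : C -> C, forall z, in_square 0 0 1 z -> ccont s z /\ s z ^+ 2 = h z.
Proof.
move=> hc h0.
have [m m0 mP] := compact_bounded square_compact (fun z Qz => ccontV (h0 z Qz) (hc z Qz)).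
have hm z : in_square 0 0 1 z -> m^-1 <= nm (h z).
  move=> Qz; have := mP z Qz; rewrite modulusV => hh.
  by rewrite -[leRHS]invrK lef_pV2// posrE invr_gt0 modulus_gt0 h0.
have im0 : 0 < m^-1 by rewrite invr_gt0.
have [d d0 dP] := compact_equicont square_compact hc im0.
(* Points of the square have modulus at most 2, so consecutive points of a ray are less than [d]
   apart, and the ratio of the values of [h] there is within 1 of 1: [psqrt] applies to it. *)
pose n := (Num.bound (2 / d)).+1.
have n0 : 0 < n%:R :> R by rewrite ltr0n.
have nd : 2 / n%:R < d.
  have h2 : 0 <= 2 / d by rewrite divr_ge0// ltW.
  have := archi_boundP h2; rewrite ltr_pdivrMr// ltr_pdivrMr// => hb.
  by apply: lt_le_trans hb _; rewrite mulrC ler_pM2l// ler_nat.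
pose rr k : R := k%:R / n%:R.
have r01 k : (k <= n)%N -> 0 <= rr k <= 1.
  by move=> kn; rewrite divr_ge0//= ler_pdivrMr// mul1r ler_nat.
have QM (t : R) z : 0 <= t <= 1 -> in_square 0 0 1 z -> in_square 0 0 1 (t%:C * z).
  case: z => x y; rewrite /in_square /= !mul0r subr0 addr0 !add0r => /andP[t0 t1].
  move=> /andP[/andP[x0 x1] /andP[y0 y1]].
  by rewrite !mulr_ge0//= !mulr_ile1.
have stepc k z : (k <= n)%N -> in_square 0 0 1 z -> ccont (fun z => h ((rr k)%:C * z)) z.
  move=> kn Qz; apply: (ccont_comp (f := fun z => (rr k)%:C * z)).
    by apply: ccontM; [exact: ccont_cst|exact: ccont_id].
  by apply: hc; apply: QM => //; exact: r01.
have : exists s : C -> C, forall z, in_square 0 0 1 z ->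
    ccont s z /\ s z ^+ 2 = h ((rr n)%:C * z).
  have : (n <= n)%N by [].
  elim: {-2}n => [_|k IH kn].
    exists (fun=> sqrtc (h 0)) => z Qz; split; first exact: ccont_cst.
    by rewrite sqr_sqrtc /rr mul0r mul0r.
  have [s sP] := IH (ltnW kn).
  exists (fun z => s z * psqrt (h ((rr k.+1)%:C * z) / h ((rr k)%:C * z))) => z Qz.
  have [s1 s2] := sP z Qz.
  have Qk : in_square 0 0 1 ((rr k)%:C * z) by apply: QM => //; apply/r01/ltnW.
  have hk0 := h0 _ Qk.
  have pos : 0 < Re (h ((rr k.+1)%:C * z) / h ((rr k)%:C * z)).
    apply: near1_Re; rewrite -(divff hk0) -mulrBl modulusM modulusV.
    rewrite ltr_pdivrMr ?modulus_gt0// mul1r; apply: lt_le_trans (hm _ Qk).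
    apply: dP => //; rewrite -mulrBl modulusM -rmorphB /= modulus_real /rr -mulrBl.
    rewrite -natrB// subSnn; apply: le_lt_trans nd; rewrite mul1r mulrC.
    rewrite ger0_norm ?invr_ge0// ler_pM2r ?invr_gt0//.
    apply: le_trans (ler_modulus_ReIm _) _; move: Qz => /andP[x01 y01].
    have : `|Re z| <= 1 by rewrite ler_norml; lra.
    have : `|Im z| <= 1 by rewrite ler_norml; lra.
    lra.
  split; last by rewrite exprMn s2 (psqrtP pos).1 mulrC mulfVK.
  apply: ccontM => //; apply: (ccont_comp (f := fun z => h ((rr k.+1)%:C * z) / h ((rr k)%:C * z))).
    by apply: ccontM; [exact: stepc|apply: ccontV => //; apply: stepc => //; exact: ltnW].
  exact: psqrt_cont.
move=> [s sP]; exists s => z Qz; have [s1 s2] := sP z Qz; split => //.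
by rewrite s2 /rr divff ?gt_eqF// mul1r.
Qed.


(** * Concatenation of paths and continuation of square roots along them *)

Definition C01 (x : R) : C := (clamp 0 1 x)%:C.

Lemma C01_id x : 0 <= x <= 1 -> C01 x = x%:C.
Proof. by move=> h; rewrite /C01 clamp_id// add0r. Qed.

Lemma C01_ge1 x : 1 <= x -> C01 x = 1.
Proof. by move=> h; rewrite /C01 /clamp add0r min_l// max_r. Qed.

Lemma C01_le0 x : x <= 0 -> C01 x = 0.
Proof. by move=> h; rewrite /C01 /clamp add0r min_r ?max_l// (le_trans h). Qed.

Lemma C01P x : exists2 t, 0 <= t <= 1 & C01 x = t%:C.
Proof.
exists (clamp 0 1 x) => //.
by have := clamp_itv 0 x (@ler01 R); rewrite add0r.
Qed.

Lemma C01_cont (g : C -> R) (L : R) z : 0 < L ->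
  (forall w, `|g w - g z| <= L * nm (w - z)) -> ccont (fun w => C01 (g w)) z.
Proof.
move=> L0 gL e e0; exists (e / L) => [|w wz]; first by rewrite divr_gt0.
rewrite /C01 -rmorphB modulus_real; apply: le_lt_trans (clamp_dist _ _ _ _) _.
by apply: le_lt_trans (gL w) _; rewrite mulrC -ltr_pdivlMr.
Qed.

Lemma Re_lip (z w : C) : `|Re w - Re z| <= nm (w - z).
Proof. by rewrite -raddfB; exact: ler_Re_modulus. Qed.

Lemma Im_lip (z w : C) : `|Im w - Im z| <= nm (w - z).
Proof. by rewrite -raddfB; exact: ler_Im_modulus. Qed.

(* [g1 (lo x) + g2 (hi x) - g2 0] is the concatenation of the paths [g1] and
   [g2].  Paths are maps of the whole plane, of which only the restriction to the
   real segment [[0, 1]] matters. *)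
Definition lo (z : C) := C01 (2 * Re z).
Definition hi (z : C) := C01 (2 * Re z - 1).

Lemma lo_cont z : ccont lo z.
Proof.
apply: (@C01_cont _ 2) => // w; rewrite -mulrBr normrM ger0_norm// ler_pM2l//.
exact: Re_lip.
Qed.

Lemma hi_cont z : ccont hi z.
Proof.
apply: (@C01_cont _ 2) => // w.
rewrite (_ : _ - _ = 2 * (Re w - Re z)); last by ring.
by rewrite normrM ger0_norm// ler_pM2l// Re_lip.
Qed.

Lemma lohi (t : R) : 0 <= t <= 1 ->
  (exists2 u, 0 <= u <= 1 & lo t%:C = u%:C /\ hi t%:C = 0) \/
  (exists2 u, 0 <= u <= 1 & lo t%:C = 1 /\ hi t%:C = u%:C).
Proof.
move=> t01; rewrite /lo /hi /=; have [h|h] := leP (2 * t) 1.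
  left; exists (2 * t); first lra.
  by rewrite C01_id ?C01_le0//; lra.
right; exists (2 * t - 1); first lra.
by rewrite C01_ge1 1?C01_id//; lra.
Qed.

Lemma lohi0 : lo 0 = 0 /\ hi 0 = 0.
Proof. by rewrite /lo /hi /= !C01_le0//; lra. Qed.

Lemma lohi1 : lo 1 = 1 /\ hi 1 = 1.
Proof. by rewrite /lo /hi /= !C01_ge1//; lra. Qed.

Section branch.
Variables (D : set R[i]^o) (f : C -> C).
Hypothesis scD : simply_connected_domain D.
Hypothesis fc : forall z, D z -> ccont f z.
Hypothesis f0 : forall z, D z -> f z != 0.

(** The null homotopy pulls [f] back to the unit square, where a square root [sg] exists. Three
    sides are mapped to the base point, so [sg] is constant along them and agrees at the two ends of
    the fourth side, which carries the loop. *)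
Lemma loop_lift (g s : C -> C) :
  (forall t : R, 0 <= t <= 1 -> ccont g t%:C) -> (forall t : R, 0 <= t <= 1 -> ccont s t%:C) ->
  (forall t : R, 0 <= t <= 1 -> D (g t%:C) /\ s t%:C ^+ 2 = f (g t%:C)) ->
  g 0 = g 1 -> s 0 = s 1.
Proof.
move=> gc sc gs g01.
pose gamma (t : R) : R[i]^o := g t%:C.
have gammac : {within `[0, 1], continuous gamma}.
  apply: continuous_in_subspaceT => t; rewrite inE /= in_itv /= => t01.
  apply/(@cvg_modulusP _ _ (nbhs t)) => e e0; have [d d0 dP] := gc t t01 e e0.
  apply/nbhs_ballP; exists d => // u ut; apply: dP.
  by rewrite -rmorphB modulus_real distrC; exact: ut.
have gammaD : gamma @` `[0, 1] `<=` D.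
  by move=> _ [t /= + <-]; rewrite in_itv /= => /gs[].
have z01 : 0 <= (0 : R) <= 1 by rewrite lexx ler01.
have o01 : 0 <= (1 : R) <= 1 by rewrite lexx ler01.
have [H [Hc HD H0 H1 He]] := scD.2 gamma gammac gammaD g01.
(* Clamping turns the continuity of [H] within the square into continuity on the plane. *)
pose h (z : C) := f (H (clamp 0 1 (Re z), clamp 0 1 (Im z))).
have cl x : (clamp 0 1 x : R) \in `[0, 1].
  by have := clamp_itv 0 x (@ler01 R); rewrite add0r in_itv.
have HDz (z : C) : D (H (clamp 0 1 (Re z), clamp 0 1 (Im z))).
  by apply: HD; exists (clamp 0 1 (Re z), clamp 0 1 (Im z)) => //; split => /=; exact: cl.
have hc z : in_square 0 0 1 z -> ccont h z.
  move=> Qz; apply: (ccont_comp (f := fun z => H (clamp 0 1 (Re z), clamp 0 1 (Im z)))); last first.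
    exact/fc.
  move=> e e0; set p := (clamp 0 1 (Re z), clamp 0 1 (Im z)).
  have := Hc; rewrite subspace_continuousP => /(_ p) => /(_ (conj (cl _) (cl _))).
  move=> /cvg_modulusP/(_ e e0)[[A B] /= [/nbhs_ballP[d1 /= d10 A1] /nbhs_ballP[d2 /= d20 B1]] AB].
  exists (Num.min d1 d2) => [|w]; first by rewrite lt_min d10.
  rewrite lt_min => /andP[w1 w2]; apply: (AB (clamp 0 1 (Re w), clamp 0 1 (Im w))).
    split => /=; [apply: A1|apply: B1].
      rewrite /ball /=; apply: le_lt_trans (clamp_dist _ _ _ _) _.
      by rewrite distrC; apply: le_lt_trans (Re_lip _ _) _.
    rewrite /ball /=; apply: le_lt_trans (clamp_dist _ _ _ _) _.
    by rewrite distrC; apply: le_lt_trans (Im_lip _ _) _.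
  by split => /=; exact: cl.
have [sg sgP] := square_lift hc (fun z _ => f0 (HDz z)).
have hE (x y : R) : 0 <= x <= 1 -> 0 <= y <= 1 -> h (x +i* y) = f (H (x, y)).
  by move=> hx hy; rewrite /h /= !clamp_id// add0r.
have QE (x y : R) : 0 <= x <= 1 -> 0 <= y <= 1 -> in_square 0 0 1 (x +i* y).
  by move=> hx hy; rewrite /in_square /= !add0r hx hy.
have fg0 : f (g 0) != 0 by apply: f0; have [] := gs 0 z01.
(* Along a side that [H] sends to [g 0], both [sg] and a constant are lifts of the same value. *)
have edge (a b : C) : (forall t : R, 0 <= t <= 1 -> exists2 xy : R * R,
     a + b * t%:C = xy.1 +i* xy.2 & [/\ 0 <= xy.1 <= 1, 0 <= xy.2 <= 1 & H xy = g 0]) ->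
    sg a = sg (a + b).
  move=> ab.
  have e0 : sg a ^+ 2 = f (g 0).
    have [[x y] /= xy [x01 y01 Hxy]] := ab 0 z01.
    move: xy; rewrite mulr0 addr0 => ->.
    by rewrite (sgP _ (QE _ _ x01 y01)).2 hE// Hxy.
  have := @lift_unique (fun z => sg (a + b * z)) (fun=> sg a).
  rewrite mulr0 addr0 mulr1 => h'; apply/esym/h' => //.
  - move=> t t01; have [[x y] /= xy [x01 y01 Hxy]] := ab t t01.
    apply: (ccont_comp (f := fun z => a + b * z)).
      apply: ccontD; first exact: ccont_cst.
      by apply: ccontM; [exact: ccont_cst|exact: ccont_id].
    by rewrite xy; apply: (sgP _ (QE _ _ x01 y01)).1.
  - by move=> t _; exact: ccont_cst.
  - move=> t t01; have [[x y] /= xy [x01 y01 Hxy]] := ab t t01.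
    by rewrite e0 xy (sgP _ (QE _ _ x01 y01)).2 hE// Hxy.
  - by move=> t _; rewrite -sqrf_eq0 e0.
have inI t : 0 <= t <= 1 -> t \in `[0 : R, 1] by rewrite in_itv.
have e1 : sg 0 = sg 1.
  rewrite (edge 0 1) ?add0r// => t t01; exists (t, 0) => /=; first by rewrite add0r mul1r.
  by split => //; have [] := He t (inI t t01).
have e2 : sg 1 = sg (1 + 'i).
  rewrite (edge 1 'i)// => t t01; exists (1, t) => /=.
    by apply/eqP; rewrite eq_complex /= !(mul0r, mul1r, mulr0, subr0, addr0, add0r) !eqxx.
  by split => //; have := H1 t (inI t t01).
have e3 : sg 'i = sg ('i + 1).
  rewrite (edge 'i 1)// => t t01; exists (t, 1) => /=.
    by apply/eqP; rewrite eq_complex /= !(mul0r, mul1r, mulr0, subr0, addr0, add0r) !eqxx.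
  by split => //; have [] := He t (inI t t01).
have e4 : sg 0 = sg 'i by rewrite e3 e1 e2 addrC.
have sg0 : sg 0 ^+ 2 = f (g 0).
  have Q0 : in_square 0 0 1 (0 : C) by apply: (QE 0 0).
  by rewrite (sgP _ Q0).2 (hE 0 0)// H0// in_itv.
have sg0' : sg 0 != 0 by rewrite -sqrf_eq0 sg0.
have s00 : s 0 ^+ 2 = f (g 0) by have [] := gs 0 z01.
have side (t : R) : 'i * t%:C = 0 +i* t :> C.
  by simpc.
(* On the fourth side [s] and [sg] are lifts of the same path; the factor [s 0 / sg 0], of square
   one, adjusts the initial value. *)
suff : sg ('i * 1) * (s 0 / sg 0) = s 1 by rewrite mulr1 -e4 mulrC mulfVK.
apply: (@lift_unique (fun z => sg ('i * z) * (s 0 / sg 0)) s) => //; last first.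
- by rewrite mulr0 mulrC mulfVK.
- by move=> t t01; rewrite -sqrf_eq0; have [Dg ->] := gs t t01; exact: f0.
- move=> t t01; rewrite exprMn expr_div_n s00 sg0 divff// mulr1 side.
  by rewrite (sgP _ (QE 0 t z01 t01)).2 hE// H0 ?inI//; have [_ ->] := gs t t01.
- move=> t t01; apply: ccontM; last exact: ccont_cst.
  apply: (ccont_comp (f := fun z => 'i * z)).
    by apply: ccontM; [exact: ccont_cst|exact: ccont_id].
  by rewrite side; apply: (sgP _ (QE 0 t z01 t01)).1.
Qed.


(** Continuation of a square root of [f] along a path: [g] is the path and [t] the root carried
    along it, from the value [s0] at [z0] to the value [s] at [z]. *)
Definition reach (z0 s0 z s : C) := exists g t : C -> C,
  [/\ (forall x, ccont g x /\ ccont t x),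
      (forall x : R, 0 <= x <= 1 -> D (g x%:C) /\ t x%:C ^+ 2 = f (g x%:C)),
      g 0 = z0 /\ t 0 = s0 & g 1 = z /\ t 1 = s].

Lemma reach_sqr z0 s0 z s : reach z0 s0 z s -> D z /\ s ^+ 2 = f z.
Proof.
move=> [g [t [_ h _ [<- <-]]]].
by apply: (h 1); rewrite ler01 lexx.
Qed.

(** [loop_lift] for the first path followed by the reverse of the second one. The factor [s / s']
    that glues the two roots has square one, and the values at the ends of the loop give
    [s0 = s * s0 / s']. *)
Lemma reach_unique z0 s0 z s s' : reach z0 s0 z s -> reach z0 s0 z s' -> s = s'.
Proof.
move=> rs rs'; have [Dz sz] := reach_sqr rs; have [_ s'z] := reach_sqr rs'.
have s'0 : s' != 0 by rewrite -sqrf_eq0 s'z f0.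
move: rs rs' => [g1 [t1 [c1 h1 [g10 t10] [g11 t11]]]] [g2 [t2 [c2 h2 [g20 t20] [g21 t21]]]].
have s00 : s0 != 0.
  rewrite -sqrf_eq0 -t10; have [|Dz0 ->] := h1 0; first by rewrite lexx ler01.
  exact: f0.
have := @loop_lift (fun x => g1 (lo x) + g2 (1 - hi x) - z) (fun x => t1 (lo x) * t2 (1 - hi x) / s').
have hc (u : C -> C) x : (forall y, ccont u y) -> ccont (fun x => u (1 - hi x)) x.
  move=> uc; apply: (ccont_comp (f := fun x => 1 - hi x)) => //.
  apply: ccontD; first exact: ccont_cst.
  by apply: ccontN; exact: hi_cont.
have lc (u : C -> C) x : (forall y, ccont u y) -> ccont (fun x => u (lo x)) x.
  by move=> uc; apply: ccont_comp => //; exact: lo_cont.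
rewrite lohi0.1 lohi0.2 lohi1.1 lohi1.2 subr0 subrr g10 g20 g11 g21 t10 t20 t11 t21.
move=> h.
have : s0 * s' / s' = s * s0 / s'.
  apply: h; last by ring.
  - move=> x _; apply: ccontD; last exact: ccont_cst.
    by apply: ccontD; [apply: lc => y; case: (c1 y)|apply: hc => y; case: (c2 y)].
  - move=> x _; apply: ccontM; last exact: ccont_cst.
    by apply: ccontM; [apply: lc => y; case: (c1 y)|apply: hc => y; case: (c2 y)].
  - move=> x x01; have [[u u01 [-> ->]]|[u u01 [-> ->]]] := lohi x01.
      rewrite subr0 g21 t21 addrK mulfK//; exact: h1.
    rewrite g11 t11 addrAC subrr add0r -rmorphB.
    have u1 : 0 <= 1 - u <= 1 by lra.
    have [Dg <-] := h2 _ u1; split=> //.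
    by rewrite !exprMn exprVn sz s'z mulrAC divff ?mul1r// f0.
rewrite mulfK// => e; apply/esym/(mulIf s00).
have := congr1 (fun x => x * s') e; rewrite mulfVK// => <-; exact: mulrC.
Qed.

(** On a disc where [f] stays within [nm (f z) / 4] of [f z], the ratios [f v / f w] have positive
    real part, so [psqrt] extends a continuation along the segment from [w] to [v]. *)
Lemma reach_local z : D z -> exists2 r : R, 0 < r &
  (forall w : C, nm (w - z) < r -> D w) /\
  forall w v : C, nm (w - z) < r -> nm (v - z) < r ->
    0 < Re (f v / f w) /\
    forall z0 s0 s, reach z0 s0 w s -> reach z0 s0 v (s * psqrt (f v / f w)).
Proof.
move=> Dz; have [[oD _ _] _] := scD; have [r1 r10 r1P] := open_modulusP oD Dz.
have fz0 : 0 < nm (f z) by rewrite modulus_gt0 f0.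
have fz4 : 0 < nm (f z) / 4 by rewrite divr_gt0.
have [r2 r20 r2P] := fc Dz fz4.
exists (Num.min r1 r2); first by rewrite lt_min r10.
have rD (w : C) : nm (w - z) < Num.min r1 r2 -> D w by rewrite lt_min => /andP[/r1P].
split=> // w v wr.
have fw : nm (f w - f z) < nm (f z) / 4.
  by move: wr; rewrite lt_min => /andP[_ /r2P].
have Dw := rD w wr.
have pos (u : C) : nm (u - z) < Num.min r1 r2 -> 0 < Re (f u / f w).
  rewrite lt_min => /andP[_ /r2P fu]; apply: near1_Re.
  rewrite -(divff (f0 Dw)) -mulrBl modulusM modulusV.
  rewrite ltr_pdivrMr ?mul1r ?modulus_gt0 ?f0//.
  have h1 := ler_modulusB (f u - f z) (f w - f z).
  have h2 := ler_modulusD (f z - f w) (f w); rewrite subrK (modulusB (f z)) in h2.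
  rewrite (_ : f u - f w = (f u - f z) - (f w - f z)); last by ring.
  lra.
move=> vr; split; first exact: pos.
move=> z0 s0 s rw; have [_ sw] := reach_sqr rw.
move: rw => [g [t [gtc gtf [g0 t0] [g1 t1]]]].
have seg (u : R) : 0 <= u <= 1 -> nm (w + u%:C * (v - w) - z) < Num.min r1 r2.
  move=> u01; rewrite (_ : _ - _ = (1 - u)%:C * (w - z) + u%:C * (v - z)); last first.
    by rewrite rmorphB; ring.
  apply: le_lt_trans (ler_modulusD _ _) _; rewrite !modulusM !modulus_real !ger0_norm; try lra.
  move: (Num.min r1 r2) wr vr => m wr vr.
  have [->|u0] := eqVneq u 0; first by rewrite subr0 mul1r mul0r addr0.
  have h1 : (1 - u) * nm (w - z) <= (1 - u) * m by rewrite ler_wpM2l//; lra.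
  have h2 : u * nm (v - z) < u * m by rewrite ltr_pM2l// lt0r u0; lra.
  lra.
exists (fun x => g (lo x) + hi x * (v - w)), (fun x => t (lo x) * psqrt (f (w + hi x * (v - w)) / f w)).
split.
- move=> x; have [gc tc] := gtc (lo x); split.
    apply: ccontD; first by apply: ccont_comp => //; exact: lo_cont.
    by apply: ccontM; [exact: hi_cont|exact: ccont_cst].
  apply: ccontM; first by apply: ccont_comp => //; exact: lo_cont.
  have [u u01 hu] := C01P (2 * Re x - 1).
  apply: (ccont_comp (f := fun x => f (w + hi x * (v - w)) / f w)).
    apply: ccontM; last exact: ccont_cst.
    apply: (ccont_comp (f := fun x => w + hi x * (v - w))).
      apply: ccontD; first exact: ccont_cst.
      by apply: ccontM; [exact: hi_cont|exact: ccont_cst].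
    by apply: fc; rewrite /hi hu; apply: rD; exact: seg.
  by apply: psqrt_cont; rewrite /hi hu; apply: pos; exact: seg.
- move=> x x01; have [[u u01 [-> ->]]|[u u01 [-> ->]]] := lohi x01.
    by rewrite !mul0r !addr0 divff ?f0// psqrt1 mulr1; exact: gtf.
  rewrite g1 t1; split; first by apply: rD; exact: seg.
  rewrite exprMn (psqrtP (pos _ (seg _ u01))).1 sw mulrC mulfVK// f0//.
- by rewrite !lohi0.1 !lohi0.2 !mul0r !addr0 divff ?f0// psqrt1 mulr1.
- by rewrite !lohi1.1 !lohi1.2 !mul1r !(addrC w) !subrK g1 t1 (addrC w) subrK.
Qed.

(** Connectedness: by [reach_local], used from the centre outwards and then from a nearby point back
    to the centre, the set of reachable points is open and relatively closed in [D]. *)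
Lemma reach_all : exists z0 s0, forall z, D z -> exists s, reach z0 s0 z s.
Proof.
have [[oD [z0 Dz0] cD] _] := scD.
pose s0 := sqrtc (f z0); exists z0, s0.
pose B : set R[i]^o := [set z | D z /\ exists s, reach z0 s0 z s].
suff -> : D = B by move=> z [].
apply/esym/cD.
- exists z0; split=> //; exists s0, (fun=> z0), (fun=> s0); split=> //.
    by move=> x; split; exact: ccont_cst.
  by move=> x _; rewrite sqr_sqrtc.
- exists B; last by apply/seteqP; split=> [z [Dz Bz]|z []].
  apply: modulus_open => z [Dz [s rs]]; have [r r0 [rD rP]] := reach_local Dz.
  exists r => // w wr; split; first exact: rD.
  have zr : nm (z - z) < r by rewrite subrr modulus0.
  by have [_ /(_ _ _ _ rs) rw] := rP z w zr wr; eexists; exact: rw.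
- exists (~` (D `\` B)); last first.
    apply/seteqP; split=> [z Bz|z [Dz] /not_andP[//|]].
      by split; [case: Bz|move=> [_]].
    by apply: contra_notP => Bz.
  apply: open_closedC; apply: modulus_open => z [Dz nBz].
  have [r r0 [rD rP]] := reach_local Dz; exists r => // w wr; split; first exact: rD.
  move=> [Dw [s rs]]; apply: nBz; split => //.
  have zr : nm (z - z) < r by rewrite subrr modulus0.
  by have [_ /(_ _ _ _ rs) rw] := rP w z wr zr; eexists; exact: rw.
Qed.

End branch.

(** Unique continuation makes the root a function, locally a multiple of [psqrt (f w / f z)] and
    hence continuous. Dividing [(s w - s z) * (s w + s z) = q w * (w - z)] by [s w + s z] then
    exhibits its derivative. *)
Lemma holo_sqrt (D : set R[i]^o) (f : C -> C) : simply_connected_domain D ->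
  (forall z, D z -> holo f z) -> (forall z, D z -> f z != 0) ->
  exists s : C -> C, forall z, D z -> holo s z /\ s z ^+ 2 = f z.
Proof.
move=> scD fh f0; have fc z : D z -> ccont f z by move=> /fh[l]; exact: cdiff_cont.
have [z0 [s0 rall]] := reach_all scD fc f0.
have ex (z : C) : exists s : C, D z -> reach D f z0 s0 z s.
  by have [/rall[s rs]|nD] := pselect (D z); [exists s|exists 0].
have [s sP] := choice ex; exists s => z Dz; have [_ s2] := reach_sqr (sP z Dz); split=> //.
have [r r0 [rD rP]] := reach_local scD fc f0 Dz.
have zr : nm (z - z) < r by rewrite subrr modulus0.
have sloc (w : C) : nm (w - z) < r -> 0 < Re (f w / f z) /\ s w = s z * psqrt (f w / f z).
  move=> wr; have [pos /(_ _ _ _ (sP z Dz)) rw] := rP z w zr wr; split=> //.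
  exact: reach_unique scD fc f0 _ _ _ _ _ (sP w (rD w wr)) rw.
have sc : ccont s z.
  apply: (@eq_ccont _ (fun w => s z * psqrt (f w / f z))).
    by exists r => // w /sloc[].
  apply: ccontM; first exact: ccont_cst.
  apply: (ccont_comp (f := fun w => f w / f z)).
    by apply: ccontM; [exact: fc|exact: ccont_cst].
  by apply: psqrt_cont; have [] := sloc z zr.
have sz0 : s z != 0 by rewrite -sqrf_eq0 s2 f0.
have [l [q qc [qz fq]]] := fh z Dz.
have s0' : 0 < nm (s z) by rewrite modulus_gt0.
have [r1 r10 r1P] := sc _ s0'.
have ss0 w : nm (w - z) < r1 -> s w + s z != 0.
  move=> /r1P; apply: contraL => /eqP h; rewrite -leNgt.
  rewrite (_ : s w - s z = - (2%:C * s z)); last first.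
    rewrite (_ : s w = - s z); last by apply/eqP; rewrite -addr_eq0 h.
    by rewrite rmorphMn /=; ring.
  by rewrite modulusN modulusM modulus_real ger0_norm// ler_peMl ?modulus_ge0//; lra.
exists (q z / (s z + s z)).
apply: (@eq_cdiff _ (fun w => s z + q w / (s w + s z) * (w - z))).
  exists (Num.min r r1) => [|w]; first by rewrite lt_min r0.
  rewrite lt_min => /andP[wr /ss0 wr1].
  have h : (s w - s z) * (s w + s z) = q w * (w - z).
    rewrite -subr_sqr s2; have [_ ->] := reach_sqr (sP w (rD w wr)).
    by rewrite fq [f z + _]addrC addrK.
  by rewrite mulrAC -h mulfK// addrC subrK.
exists (fun w => q w / (s w + s z)); last by split=> // w; rewrite subrr mulr0 addr0.
apply: ccontM => //; apply: ccontV; first by apply: ss0; rewrite subrr modulus0.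
by apply: ccontD => //; exact: ccont_cst.
Qed.

End SquareRoot.

(** * Harnack's inequality and compactness *)

Section Trap.
Context {R : realType}.
Local Notation C := R[i].

Lemma holo_cst (c z : C) : holo (fun=> c) z.
Proof. by eexists; exact: cdiff_cst. Qed.

Lemma holo_id (z : C) : holo id z.
Proof. by eexists; exact: cdiff_id. Qed.

Lemma holoD (f g : C -> C) z : holo f z -> holo g z -> holo (fun w => f w + g w) z.
Proof. by move=> [l fl] [m gm]; eexists; exact: cdiffD fl gm. Qed.

Lemma holoN (f : C -> C) z : holo f z -> holo (fun w => - f w) z.
Proof. by move=> [l fl]; eexists; exact: cdiffN fl. Qed.

Lemma holoM (f g : C -> C) z : holo f z -> holo g z -> holo (fun w => f w * g w) z.
Proof. by move=> [l fl] [m gm]; eexists; exact: cdiffM fl gm. Qed.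

Lemma holoV (f : C -> C) z : f z != 0 -> holo f z -> holo (fun w => (f w)^-1) z.
Proof. by move=> f0 [l fl]; exact: cdiffV fl. Qed.

Lemma holo_comp (f g : C -> C) z : holo f z -> holo g (f z) -> holo (fun w => g (f w)) z.
Proof. by move=> [l fl] [m gm]; eexists; exact: cdiff_comp fl gm. Qed.

Lemma holo_cont (f : C -> C) z : holo f z -> ccont f z.
Proof. by move=> [l fl]; exact: cdiff_cont fl. Qed.

Lemma unimodular_rotation (x : C) : exists2 c : C, nm c = 1 & c * x = (nm x)%:C.
Proof.
have [->|x0] := eqVneq x 0; first by exists 1; rewrite ?modulus1// modulus0 mulr0.
exists ((nm x)%:C / x); last by rewrite mulfVK.
rewrite modulusM modulusV modulus_real ger0_norm ?modulus_ge0// mulfV//.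
by rewrite modulus_eq0.
Qed.

(* Schwarz's lemma for the Cayley transform of [1 - c q], where the unimodular
   [c] makes [c * q z] nonnegative. *)
Lemma harnack (q : C -> C) (z : C) (r : R) : 0 < r ->
  (forall w, nm (w - z) <= 2 * r -> holo q w) ->
  (forall w, nm (w - z) <= 2 * r -> nm (q w) < 1) ->
  forall w, nm (w - z) <= r / 2 ->
    1 - nm (q w) <= (1 + 4 / r * nm (w - z)) * (1 - nm (q z)).
Proof.
move=> r0 qh q1 w wr; have [c c1 cz] := unimodular_rotation (q z).
pose s := 1 - nm (q z).
have s0 : 0 < s.
  have : nm (q z) < 1 by apply: q1; rewrite subrr modulus0; lra.
  rewrite /s; lra.
pose F v := 1 - c * q v.
have ReF v : nm (v - z) <= 2 * r -> 0 < Re (F v).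
  move=> /q1 qv; rewrite /F raddfB /=.
  have : Re (c * q v) <= nm (c * q v) by apply: le_trans (ler_norm _) (ler_Re_modulus _).
  rewrite modulusM c1; lra.
have Fs0 v : nm (v - z) <= 2 * r -> F v + s%:C != 0.
  move=> /ReF Fv; apply/eqP => /(congr1 (@complex.Re R)); rewrite raddfD /=; lra.
pose psi v := (F v - s%:C) / (F v + s%:C).
have psiz : psi z = 0 by rewrite /psi /F cz /s rmorphB /= subrr mul0r.
have psi1 v : nm (v - z) <= 2 * r -> nm (psi v) <= 1.
  move=> vz; rewrite /psi modulusM modulusV ler_pdivrMr ?mul1r; last first.
    by rewrite modulus_gt0 Fs0.
  have := ReF v vz; case: (F v) => x y /= x0; rewrite /modulus ler_wsqrtr//=.
  have : 0 <= x * s by rewrite mulr_ge0// ltW.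
  rewrite !expr2; lra.
have zz : nm (z - z) <= 2 * r by rewrite subrr modulus0; lra.
have Fh v : nm (v - z) <= 2 * r -> holo F v.
  move=> vz; apply: holoD; first exact: holo_cst.
  by apply: holoN; apply: holoM; [exact: holo_cst|exact: qh].
have psih v : nm (v - z) <= 2 * r -> holo psi v.
  move=> vz; apply: holoM; first by apply: holoD; [exact: Fh|exact: holo_cst].
  apply: holoV; first exact: Fs0.
  by apply: holoD; [exact: Fh|exact: holo_cst].
have := @holo_slope _ psi z r 1 r0 psih.
rewrite psiz => /(_ _ w); rewrite subr0 => hpsi.
have {}hpsi : nm (psi w) <= nm (w - z) / r.
  rewrite mulrC -[r^-1]mul1r; apply: hpsi; last lra.
  by move=> v vz; rewrite subr0 psi1.
have wz : nm (w - z) <= 2 * r by lra.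
pose l := nm (w - z) / r.
have l0 : 0 <= l by rewrite divr_ge0 ?modulus_ge0// ltW.
have l1 : l <= 1 / 2 by rewrite ler_pdivrMr//; lra.
have e : F w * (1 - psi w) = s%:C * (1 + psi w).
  by rewrite /psi; field; exact: Fs0.
have h1 : nm (F w) * (1 - l) <= s * (1 + l).
  have : nm (F w * (1 - psi w)) <= s * (1 + l).
    rewrite e modulusM modulus_real (ger0_norm (ltW s0)) ler_pM2l//.
    apply: le_trans (ler_modulusD _ _) _; rewrite modulus1 lerD2l; exact: hpsi.
  apply: le_trans; rewrite modulusM ler_wpM2l ?modulus_ge0//.
  have := ler_modulusD (1 - psi w) (psi w); rewrite subrK modulus1.
  move: hpsi; rewrite -/l; lra.
(* [(1 + l) / (1 - l) <= 1 + 4 * l] as long as [l <= 1 / 2], which is why [w] is taken within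
   [r / 2] of [z]. *)
have h2 : nm (F w) <= s * (1 + 4 * l).
  have l2 : 0 < 1 - l by lra.
  rewrite -(ler_pM2r l2); apply: le_trans h1 _; rewrite -mulrA ler_pM2l//.
  have : 0 <= l * (1 / 2 - l) by rewrite mulr_ge0//; lra.
  lra.
have h3 : 1 - nm (q w) <= nm (F w).
  have := ler_modulusD (F w) (c * q w); rewrite /F subrK modulus1 modulusM c1; lra.
rewrite [_ * (1 - _)]mulrC -/s mulrAC -mulrA -/l.
exact: le_trans h3 h2.
Qed.

Section domain.
Variable D : set R[i]^o.
Hypothesis scD : simply_connected_domain D.

Lemma holo_root (n : nat) (f : C -> C) :
  (forall z, D z -> holo f z) -> (forall z, D z -> f z != 0) ->
  exists q : C -> C, forall z, D z -> holo q z /\ q z ^+ (2 ^ n) = f z.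
Proof.
move=> fh f0; elim: n => [|n [q qP]].
  by exists f => z Dz; split; [exact: fh|rewrite expn0 expr1].
have [||s sP] := @holo_sqrt _ _ q scD.
- by move=> z /qP[].
- move=> z Dz; have [_ qz] := qP z Dz; apply/eqP => q0; have := f0 z Dz.
  by rewrite -qz q0 expr0n expn_eq0 eqxx.
exists s => z Dz; have [hs s2] := sP z Dz; split => //.
by rewrite expnS exprM s2; have [] := qP z Dz.
Qed.

(** For [a] outside [D], a square root [s] of [z - a] never takes two opposite values, so it omits a
    disc around [- s z0] and [b = 1 / (s + s z0)] is bounded. The inverse [beta] is explicit. *)
Lemma bounded_embedding : D <> setT -> exists (b beta : C -> C) (B : R),
  [/\ (forall z, D z -> holo b z), (forall z, D z -> nm (b z) <= B),
      (forall z, D z -> b z != 0 /\ beta (b z) = z), (forall z, z != 0 -> ccont beta z) &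
      open (b @` D : set R[i]^o)].
Proof.
move=> DT; have [a Da] : exists a : C, ~ D a.
  by apply: contra_notP DT => /forallNP h; apply/seteqP; split=> // z _; apply: contrapT; exact: h.
have [[oD [z0 Dz0] _] _] := scD.
have [||s sP] := @holo_sqrt _ _ (fun z => z - a) scD.
- by move=> z _; apply: holoD; [exact: holo_id|exact: holo_cst].
- by move=> z Dz; rewrite subr_eq0; apply/eqP => za; apply: Da; rewrite -za.
have snz z : D z -> s z != 0.
  move=> Dz; rewrite -sqrf_eq0 (sP z Dz).2 subr_eq0; apply/eqP => za.
  by apply: Da; rewrite -za.
have s00 : 0 < nm (s z0) by rewrite modulus_gt0 snz.
have two0 : (2 : C) != 0 by rewrite pnatr_eq0.
(* A disc centred at [z] whose boundary passes through the origin contains no two opposite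
   points. *)
have same (x y : C) (z : C) : x ^+ 2 = y ^+ 2 -> nm (x - z) < nm z -> nm (y - z) < nm z -> x = y.
  move=> xy xz yz; move/eqP: xy; rewrite eqf_sqr => /orP[/eqP //|/eqP xy].
  exfalso; move: xz; rewrite xy -opprD modulusN => xz.
  have := ler_modulusB (y + z) (y - z).
  rewrite (_ : y + z - (y - z) = z + z); last by ring.
  rewrite -mulr2n -mulr_natl modulusM (_ : nm (2 : C) = 2); first lra.
  by have := @modulus_real R 2; rewrite ger0_norm// rmorph_nat.
(* [s] omits a neighbourhood of [- s z0], because it covers one of [s z0]. *)
have cover z1 : D z1 -> exists2 d : R, 0 < d & forall x : C, nm (x - s z1) < d ->
    exists2 z, D z & s z = x.
  move=> Dz1; have [r r0 rP] := open_modulusP oD Dz1.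
  have s10 : 0 < nm (s z1) by rewrite modulus_gt0 snz.
  have [r1 r10 r1P] := holo_cont (sP z1 Dz1).1 s10.
  have pc : ccont (fun x => x ^+ 2 + a) (s z1).
    by apply: ccontD; [apply: ccontX; exact: ccont_id|exact: ccont_cst].
  have rr : 0 < Num.min r r1 by rewrite lt_min r0.
  have [d d0 dP] := pc _ rr; exists (Num.min d (nm (s z1))); first by rewrite lt_min d0.
  move=> x; rewrite lt_min => /andP[/dP + xs].
  rewrite (sP z1 Dz1).2 subrK lt_min => /andP[/rP Dx /r1P sx].
  exists (x ^+ 2 + a) => //; apply: (same _ _ (s z1)) => //.
  by rewrite (sP _ Dx).2 addrK.
have [d d0 dP] := cover z0 Dz0.
have sd z : D z -> d <= nm (s z + s z0).
  move=> Dz; rewrite leNgt; apply/negP => sz.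
  have [|w Dw sw] := dP (- s z).
    by rewrite -opprD modulusN.
  have wz : w = z.
    by rewrite -[w](subrK a) -[z](subrK a) -(sP w Dw).2 -(sP z Dz).2 sw sqrrN.
  move: sw; rewrite wz => /eqP; rewrite -addr_eq0 -mulr2n -mulr_natl mulf_eq0.
  by rewrite (negbTE two0) (negbTE (snz z Dz)).
have sn z : D z -> s z + s z0 != 0.
  by move=> /sd h; rewrite -modulus_gt0; apply: lt_le_trans h.
pose b z := (s z + s z0)^-1; pose beta (x : C) := (x^-1 - s z0) ^+ 2 + a.
have bb z : D z -> b z != 0 /\ beta (b z) = z.
  move=> Dz; rewrite /b /beta invr_eq0 sn// invrK addrK (sP z Dz).2 subrK.
  by split.
have betac z : z != 0 -> ccont beta z.
  move=> zn; apply: ccontD; last exact: ccont_cst.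
  apply: ccontX; apply: ccontD; last exact: ccont_cst.
  by apply: ccontV => //; exact: ccont_id.
exists b, beta, d^-1; split => //.
- move=> z Dz; apply: holoV; first exact: sn.
  by apply: holoD; [exact: (sP z Dz).1|exact: holo_cst].
- by move=> z Dz; rewrite /b modulusV lef_pV2 ?sd// posrE// modulus_gt0 sn.
apply: modulus_open => _ [z Dz <-].
have [d1 d10 d1P] := cover z Dz.
have [bn _] := bb z Dz.
have vc : ccont (fun x => x^-1 - s z0) (b z).
  by apply: ccontD; [apply: ccontV => //; exact: ccont_id|exact: ccont_cst].
have [d2 d20 d2P] := vc _ d10.
exists (Num.min d2 (nm (b z))); first by rewrite lt_min d20 modulus_gt0.
move=> x; rewrite lt_min => /andP[/d2P + xb]; rewrite {2}/b invrK addrK => /d1P[w Dw sw].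
by exists w => //; rewrite /b sw subrK invrK.
Qed.

(* For [p] outside the image of [b], the functions [q] obtained as [2 ^ k]-th
   roots of normalisations of [b - p] keep [b w] away from [p]. *)
Lemma trap (K : set R[i]^o) (N : R) : D <> setT -> compact K -> K `<=` D -> 1 <= N ->
  exists K' : set R[i]^o, [/\ compact K', K' `<=` D &
    forall z w : C, K z -> D w ->
      (forall q : C -> C, (forall v, D v -> holo q v /\ nm (q v) < 1) ->
         1 - nm (q w) <= N * (1 - nm (q z))) -> K' w].
Proof.
move=> DT cK KD N1; have [b [beta [B [bh bB bb betac oO]]]] := bounded_embedding DT.
set O := b @` D in oO.
have B0 : 0 <= B.
  have [[_ [z0 Dz0] _] _] := scD; exact: le_trans (modulus_ge0 _) (bB z0 Dz0).
have cbK : compact (b @` K : set R[i]^o).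
  by apply: compact_image => // z /KD/bh; exact: holo_cont.
have bKO : b @` K `<=` O by move=> _ [z /KD Dz <-]; exists z.
have [r r0 rP] := compact_margin oO cbK bKO.
(* [S] exceeds every [nm (b v - p)] with [nm p <= B + 1], so that [(b - p) / S] maps [D] into the
   unit disc. *)
pose S := 2 * B + 2; have S0 : 0 < S by rewrite /S; lra.
(* Chosen so that [nm (q z) >= 1 - t] forces [nm (q w) >= 1 / 2] through the hypothesis with factor
   [N]. *)
pose t : R := 1 / (2 * N).
have t0 : 0 < t by rewrite divr_gt0//; lra.
have tN : N * t = 1 / 2 by rewrite /t; field; rewrite gt_eqF//; lra.
have t1 : t <= 1 / 2 by rewrite -tN ler_peMl//; lra.
have [k kP] : exists k : nat, r^-1 * S < ((1 - t)^-1) ^+ k.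
  by apply: pow_unbounded; rewrite invf_gt1; lra.
(* A power of two, since roots are extracted by iterated square roots, large enough that
   [(1 - t) ^+ n <= r / S]: then [nm (f z) >= r / S] yields [nm (q z) >= 1 - t]. *)
pose n := (2 ^ k)%N.
have nP : (1 - t) ^+ n <= r / S.
  have h1 : (1 - t) ^+ n <= (1 - t) ^+ k.
    by apply: ler_wiXn2l; [lra|lra|rewrite /n ltnW// ltn_expl].
  apply: le_trans h1 _; have p0 : 0 < (1 - t) ^+ k by rewrite exprn_gt0//; lra.
  move: kP; rewrite exprVn -[X in _ < X]div1r ltr_pdivlMr// -mulrA mulrC ltr_pdivrMr//.
  by rewrite mul1r ler_pdivlMr// mulrC => /ltW.
pose K2 : set R[i]^o := [set x | nm x <= B /\
  forall p : C, ~ O p -> nm p <= B + 1 -> S * (1 / 2) ^+ n <= nm ((x : C) - p)].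
have c0 : 0 < S * (1 / 2) ^+ n by rewrite mulr_gt0// exprn_gt0.
have K2O : K2 `<=` O.
  move=> x [xB xp]; apply: contrapT => Ox; have := xp x Ox.
  rewrite subrr modulus0; have : nm x <= B + 1 by lra.
  by move=> h /(_ h); lra.
have cK2 : compact K2.
  apply: (@closed_bounded_compact _ _ B) => [|x []//].
  apply: modulus_closed => x h; split.
    apply/ler_addgt0Pl => e e0; have [w [wB _] wx] := h e e0.
    rewrite -[x : C](subrK w); apply: le_trans (ler_modulusD _ _) _; rewrite modulusB; lra.
  move=> p Op pB; apply/ler_addgt0Pl => e e0; have [w [_ wp] wx] := h e e0.
  have := wp p Op pB; have := ler_modulusD (w - x) (x - p).
  rewrite (_ : w - x + (x - p) = w - p); last by ring.
  by lra.
exists (beta @` K2); split.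
- apply: compact_image => // x /K2O[z Dz <-]; apply: betac.
  by have [] := bb z Dz.
- by move=> _ [x /K2O[z Dz <-] <-]; have [_ ->] := bb z Dz.
move=> z w Kz Dw hq; exists (b w); last by have [] := bb w Dw.
split=> [|p Op pB]; first exact: bB.
pose f v := (b v - p) / S%:C.
have fnm v : nm (f v) = nm (b v - p) / S.
  by rewrite /f modulusM modulusV modulus_real ger0_norm// ltW.
have fn v : D v -> f v != 0.
  move=> Dv; rewrite -modulus_gt0 fnm divr_gt0// modulus_gt0 subr_eq0.
  by apply/eqP => bvp; apply: Op; exists v.
have fh v : D v -> holo f v.
  move=> Dv; apply: holoM; last exact: holo_cst.
  by apply: holoD; [exact: bh|exact: holo_cst].
have f1 v : D v -> nm (f v) < 1.
  move=> Dv; rewrite fnm ltr_pdivrMr// mul1r.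
  apply: le_lt_trans (ler_modulusB _ _) _; have := bB v Dv; rewrite /S; lra.
have [q qP] := holo_root k fh fn.
have qn v : D v -> nm (q v) ^+ n = nm (f v).
  by move=> Dv; rewrite -modulusX; have [_ ->] := qP v Dv.
have n0 : (0 < n)%N by rewrite expn_gt0.
have q1 v : D v -> nm (q v) < 1.
  by move=> Dv; rewrite -(@expr_lt1 _ n) ?modulus_ge0// qn// f1.
have {}hq := hq q (fun v Dv => conj (qP v Dv).1 (q1 v Dv)).
have Dz := KD z Kz.
have qz : 1 - t <= nm (q z).
  rewrite leNgt; apply/negP => qzt.
  have : nm (q z) ^+ n < (1 - t) ^+ n by rewrite ltrXn2r ?modulus_ge0// -?lt0n//; lra.
  apply/negP; rewrite -leNgt qn// fnm; apply: le_trans nP _.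
  rewrite ler_pM2r ?invr_gt0// leNgt; apply/negP => h; apply: Op.
  by apply: (rP (b z)); [exists z|rewrite modulusB].
have qw : 1 / 2 <= nm (q w).
  have : N * (1 - nm (q z)) <= N * t by rewrite ler_pM2l//; lra.
  rewrite tN; lra.
have : (1 / 2) ^+ n <= nm (f w).
  by rewrite -qn// lerXn2r ?nnegrE ?modulus_ge0//; lra.
by rewrite fnm ler_pdivlMr// mulrC.
Qed.

End domain.
End Trap.

(** * Flows and generators *)

Section Generators.
Context {R : realType}.
Local Notation C := R[i].
Variables (D : set R[i]^o) (U : set {family compactly_in D, R[i]^o -> R[i]^o}).
Hypothesis scD : simply_connected_domain D.
Hypothesis DT : D <> setT.
Hypothesis semU : semigroup_of_self_maps D U.

Lemma U_holo (g : C -> C) : U g -> forall z, D z -> holo g z /\ D (g z).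
Proof.
have [UH _ _] := semU; move=> /UH[gd gD] z Dz; split; last exact: gD.
by apply/derivable_cdiff; exact: gd.
Qed.

Lemma U_iter (g : C -> C) k : U g -> U (iter k g).
Proof.
have [_ U1 Uc] := semU; move=> Ug; elim: k => [|k IH]; first exact: U1.
exact: (Uc g (iter k g)).
Qed.

Lemma domain_open : open D. Proof. by have [[]] := scD. Qed.

(** * Estimates for Euler polygons *)

Section flow.
Variable phi : C -> C.
Hypothesis phih : forall z, D z -> holo phi z.

(** A pair [(g, h)] is one step of length [h] for the equation [w' = - phi w]; the single tolerance
    [e] bounds both the length and the error per unit of time. *)
Definition Euler_step (K : set R[i]^o) (e : R) (p : (C -> C) * R) :=
  [/\ U p.1, 0 < p.2 < e & forall z : C, K z -> nm (z - p.1 z - p.2%:C * phi z) <= e * p.2].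

Lemma Euler_stepS (K K' : set R[i]^o) (e e' : R) p : K' `<=` K -> e <= e' ->
  Euler_step K e p -> Euler_step K' e' p.
Proof.
move=> KK ee [Up he hK]; split=> //; first lra.
move=> z /KK/hK h; apply: le_trans h _; rewrite ler_wpM2r//; lra.
Qed.

(** Harnack's inequality is applied to [q] composed with [iter j g], between [z] and [g z]. Only the
    first step of the orbit is measured, so the Euler estimate is required on [K0] alone. *)
Lemma trapped (K0 : set R[i]^o) (T : R) : compact K0 -> K0 `<=` D -> 0 <= T ->
  exists K : set R[i]^o, [/\ compact K, K `<=` D & exists2 e : R, 0 < e &
    forall p, Euler_step K0 e p -> forall k, k%:R * p.2 <= T -> forall z : C, K0 z ->
      K (iter k p.1 z)].
Proof.
move=> cK0 K0D T0.
have [r r0 [K1 [cK1 K1D K01]]] := compact_fatten domain_open cK0 K0D.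
have [M M0 MP] := compact_bounded cK0 (fun z Kz => holo_cont (phih (K0D z Kz))).
pose a := r / 2; have a0 : 0 < a by rewrite divr_gt0.
(* [4 / a] is Harnack's constant and [h * (M + 1)] bounds [nm (g z - z)]. *)
pose L := 4 / a * (M + 1); have L0 : 0 < L by rewrite mulr_gt0 ?divr_gt0//; lra.
have N1 : 1 <= expR (L * T) by rewrite -expR0 ler_expR mulr_ge0// ltW.
have [K [cK KD KP]] := trap scD DT cK0 K0D N1.
exists K; split=> //; exists (Num.min 1 (a / 2 / (M + 1))).
  by rewrite lt_min ltr01 !divr_gt0//; lra.
move=> [g h] [/= Ug]; rewrite lt_min => /and3P[h0 h1 ha] gK k kh z Kz.
have Dz := K0D z Kz.
have gz : nm (g z - z) <= h * (M + 1).
  have := gK z Kz; have := MP z Kz => hM hg.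
  have hh : nm (z - g z - h%:C * phi z) <= h.
    by apply: le_trans hg _; rewrite ler_piMl ?ge_min ?lexx// ltW.
  rewrite modulusB (_ : z - g z = (z - g z - h%:C * phi z) + h%:C * phi z); last by ring.
  apply: le_trans (ler_modulusD _ _) _; rewrite modulusM modulus_real (gtr0_norm h0).
  have : h * nm (phi z) <= h * M by rewrite ler_pM2l.
  lra.
have gza : nm (g z - z) <= a / 2.
  apply: le_trans gz _; apply/ltW; rewrite -ltr_pdivlMr//; lra.
have inD v : nm (v - z) <= 2 * a -> D v.
  by move=> vz; apply: K1D; apply: (K01 z) => //; rewrite /a in vz; lra.
apply: (KP z) => //; first by have [] := U_holo (U_iter k Ug) Dz.
move=> q qD; have q1 : 0 <= 1 - nm (q z) by have [_] := qD z Dz; lra.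
have step j : 1 - nm (q (iter j g z)) <= (1 + L * h) ^+ j * (1 - nm (q z)).
  elim: j => [|j IH]; first by rewrite expr0 mul1r.
  rewrite iterSr exprS -mulrA.
  have gj v : D v -> D (iter j g v) by move=> /(U_holo (U_iter j Ug))[].
  have := @harnack _ (fun v => q (iter j g v)) z a a0 _ _ (g z) gza.
  move=> /(_ _ _)/le_trans; apply.
  - move=> w /inD Dw; apply: (holo_comp (f := iter j g)).
      by have [] := U_holo (U_iter j Ug) Dw.
    by have [] := qD _ (gj w Dw).
  - by move=> w /inD Dw; have [] := qD _ (gj w Dw).
  apply: ler_pM => //.
  - by rewrite addr_ge0// mulr_ge0 ?modulus_ge0// divr_ge0// ltW.
  - by have [_] := qD _ (gj z Dz); lra.
  rewrite lerD2l; apply: (@le_trans _ _ (4 / a * (h * (M + 1)))).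
    by rewrite ler_pM2l ?divr_gt0.
  by rewrite /L le_eqVlt; apply/orP; left; apply/eqP; ring.
apply: le_trans (step k) _; rewrite ler_wpM2r//.
apply: (@le_trans _ _ (expR (L * h) ^+ k)).
  have Lh : 0 <= L * h by rewrite mulr_ge0// ltW.
  by rewrite lerXn2r ?nnegrE ?expR_ge0 ?expR_ge1Dx//; lra.
by rewrite -expRM_natl ler_expR mulrCA ler_pM2l.
Qed.

(** Up to time [t0] the orbit stays so close to [z] that [phi] varies by less than [e / 2] along it;
    half of [e] pays for this variation and half for the errors of the steps. *)
Lemma euler (K0 : set R[i]^o) (e : R) : compact K0 -> K0 `<=` D -> 0 < e ->
  exists (K : set R[i]^o) (t0 e0 : R), [/\ compact K, K `<=` D, 0 < t0, 0 < e0 &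
    forall p, Euler_step K e0 p -> forall k, k%:R * p.2 <= t0 -> forall z : C, K0 z ->
      nm (z - iter k p.1 z - (k%:R * p.2)%:C * phi z) <= e * (k%:R * p.2)].
Proof.
move=> cK0 K0D e_gt0; have e2 : 0 < e / 2 by rewrite divr_gt0.
have [K [cK KD [e1 e10 KP]]] := trapped cK0 K0D (@ler01 R).
have [M M0 MP] := compact_bounded cK (fun z Kz => holo_cont (phih (KD z Kz))).
have [d d0 dP] := compact_equicont cK0 (fun z Kz => holo_cont (phih (K0D z Kz))) e2.
exists (K `|` K0), (Num.min 1 (d / 2 / (M + 1))), (Num.min e1 (Num.min 1 (e / 2))).
split.
- exact: compactU.
- by move=> z []; [exact: KD|exact: K0D].
- by rewrite lt_min ltr01 !divr_gt0//; lra.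
- by rewrite !lt_min e10 ltr01.
move=> [g h] st k; rewrite le_min => /andP[/= k1 kd] z Kz.
have st0 : Euler_step K0 e1 (g, h).
  by apply: Euler_stepS st; [move=> ?; right|rewrite ge_min lexx].
have [Ug /= + gK] := st; rewrite !lt_min => /andP[h0 /and3P[_ h1 he]].
have inK j : (j <= k)%N -> K (iter j g z).
  move=> jk; apply: (KP (g, h) st0) => //=; apply: le_trans k1.
  by rewrite ler_wpM2r ?ler_nat// ltW.
have stp j : (j <= k)%N ->
    nm (iter j g z - iter j.+1 g z - h%:C * phi (iter j g z)) <= Num.min 1 (e / 2) * h.
  move=> /inK Kj; apply: le_trans (gK _ (or_introl Kj)) _ => /=.
  by rewrite ler_pM2r// ge_min lexx orbT.
have m1 : Num.min 1 (e / 2) * h <= h by rewrite ler_piMl ?ge_min ?lexx// ltW.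
have m2 : Num.min 1 (e / 2) * h <= e / 2 * h by rewrite ler_pM2r// ge_min lexx orbT.
(* The bound on the displacement is proved along with the estimate, since it gives the closeness of
   [phi] at the next step. *)
suff [//] : nm (z - iter k g z - (k%:R * h)%:C * phi z) <= e * (k%:R * h) /\
   nm (iter k g z - z) <= k%:R * h * (M + 1).
move: (leqnn k); elim: {-2}k => [_|j IH jk].
  by rewrite /= !mul0r !subrr modulus0 mulr0.
have [IH1 IH2] := IH (ltnW jk).
have := stp j (ltnW jk) => h3.
have h4 := MP _ (inK j (ltnW jk)).
have h5 : h * nm (phi (iter j g z)) <= h * M by rewrite ler_pM2l.
have h6 : nm (phi (iter j g z) - phi z) < e / 2.
  apply: dP => //; apply: le_lt_trans IH2 _.
  have : j%:R * h * (M + 1) <= k%:R * h * (M + 1).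
    by rewrite ler_wpM2r ?ler_wpM2r ?ler_nat//; [lra|exact: ltW|exact: ltnW].
  move=> /le_lt_trans; apply; move: kd; rewrite ler_pdivlMr; lra.
have h7 : h * nm (phi (iter j g z) - phi z) <= h * (e / 2) by rewrite ler_pM2l// ltW.
have jS : j.+1%:R * h = j%:R * h + h by rewrite -natr1 mulrDl mul1r.
split.
  rewrite jS (_ : z - iter j.+1 g z - (j%:R * h + h)%:C * phi z =
    (z - iter j g z - (j%:R * h)%:C * phi z) +
    ((iter j g z - iter j.+1 g z - h%:C * phi (iter j g z)) +
     h%:C * (phi (iter j g z) - phi z))); last by rewrite rmorphD /=; ring.
  apply: le_trans (ler_modulusD _ _) _.
  have := ler_modulusD (iter j g z - iter j.+1 g z - h%:C * phi (iter j g z))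
     (h%:C * (phi (iter j g z) - phi z)).
  rewrite modulusM modulus_real (gtr0_norm h0) => h8; rewrite [e * _]mulrDr.
  apply: lerD => //; lra.
rewrite jS (_ : iter j.+1 g z - z = (iter j g z - z) -
    ((iter j g z - iter j.+1 g z - h%:C * phi (iter j g z)) + h%:C * phi (iter j g z))); last by ring.
apply: le_trans (ler_modulusB _ _) _.
have := ler_modulusD (iter j g z - iter j.+1 g z - h%:C * phi (iter j g z)) (h%:C * phi (iter j g z)).
rewrite modulusM modulus_real (gtr0_norm h0) => h8; rewrite [(_ + h) * _]mulrDl.
apply: lerD => //; lra.
Qed.

(** Near [z] all the iterates take values in one compact set, hence share a bound, and
    [holo_lipschitz] makes their Lipschitz constants uniform. *)
Lemma equilip (z : C) (T : R) : D z -> 0 <= T ->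
  exists (K : set R[i]^o) (r L e : R), [/\ compact K, K `<=` D, 0 < r, 0 < L & 0 < e /\
    forall p, Euler_step K e p -> forall k, k%:R * p.2 <= T -> forall w : C, nm (w - z) < r ->
      nm (iter k p.1 w - iter k p.1 z) <= L * nm (w - z)].
Proof.
move=> Dz T0; have zD : [set z : R[i]^o] `<=` D by move=> w ->.
have [r r0 [K1 [cK1 K1D K01]]] := compact_fatten domain_open (@compact_set1 _ (z : R[i]^o)) zD.
have [K [cK KD [e e0 KP]]] := trapped cK1 K1D T0.
have [M M0 MP] := compact_bounded_id cK.
pose a := r / 2; have a0 : 0 < a by rewrite divr_gt0.
exists K1, a, (2 * M / a), e; split=> //; first by rewrite divr_gt0// mulr_gt0.
split=> // -[g h] st k kT w wz; have [Ug _ _] := st.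
have inK v : nm (v - z) <= 2 * a -> K1 v.
  by move=> vz; apply: (K01 z) => //; rewrite /a in vz; lra.
apply: holo_lipschitz => // v /inK Kv; first by have [] := U_holo (U_iter k Ug) (K1D v Kv).
by apply: MP; exact: (KP (g, h)).
Qed.


(** * The flow as a limit of Euler polygons along an ultrafilter *)

Section ultra_limit.
Variable F : set_system ((C -> C) * R).
Hypothesis FU : UltraFilter F.
Hypothesis FE : forall (K : set R[i]^o) (e : R), compact K -> K `<=` D -> 0 < e ->
  \forall p \near F, Euler_step K e p.

Definition nsteps (t : R) (p : (C -> C) * R) := Num.truncn (t / p.2).

Lemma nstepsP t p : 0 <= t -> 0 < p.2 ->
  (nsteps t p)%:R * p.2 <= t < (nsteps t p)%:R * p.2 + p.2.
Proof.
move=> t0 p0; have : 0 <= t / p.2 by rewrite divr_ge0// ltW.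
move=> /truncn_itv/andP[]; rewrite -/(nsteps t p) ler_pdivlMr// => -> /=.
by rewrite ltr_pdivrMr// -natr1 mulrDl mul1r.
Qed.

Lemma near_pos : \forall p \near F, [/\ U p.1 & 0 < p.2].
Proof.
apply: filterS (@FE set0 1 compact0 (@sub0set _ _) ltr01) => p [Up /andP[p0 _] _].
by split.
Qed.

Lemma near_trapped (K0 : set R[i]^o) (T : R) : compact K0 -> K0 `<=` D -> 0 <= T ->
  exists K : set R[i]^o, [/\ compact K, K `<=` D &
    \forall p \near F, forall k, k%:R * p.2 <= T -> forall z : C, K0 z -> K (iter k p.1 z)].
Proof.
move=> cK0 K0D T0; have [K [cK KD [e e0 KP]]] := trapped cK0 K0D T0.
exists K; split=> //; apply: filterS (FE cK0 K0D e0) => p; exact: KP.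
Qed.

Lemma near_equilip (z : C) (T : R) : D z -> 0 <= T ->
  exists r L : R, [/\ 0 < r, 0 < L &
    \forall p \near F, forall k, k%:R * p.2 <= T -> forall w : C, nm (w - z) < r ->
      nm (iter k p.1 w - iter k p.1 z) <= L * nm (w - z)].
Proof.
move=> Dz T0; have [K [r [L [e [cK KD r0 L0 [e0 KP]]]]]] := equilip Dz T0.
exists r, L; split=> //; apply: filterS (FE cK KD e0) => p; exact: KP.
Qed.

Lemma pt_in_D (z : C) : D z -> [set z : R[i]^o] `<=` D.
Proof. by move=> Dz w ->. Qed.

(** Each orbit stays in a compact subset of [D], so a single ultrafilter gives limits for all [t]
    and [z] at once, without extracting subsequences. *)
Lemma flow_ex : exists u : R -> C -> C, forall t, 0 <= t -> forall z, D z ->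
  D (u t z) /\ forall e : R, 0 < e -> \forall p \near F, nm (iter (nsteps t p) p.1 z - u t z) < e.
Proof.
have ex (tz : R * C) : exists l : C, 0 <= tz.1 -> D tz.2 ->
  D l /\ forall e : R, 0 < e -> \forall p \near F, nm (iter (nsteps tz.1 p) p.1 tz.2 - l) < e.
  case: tz => t z /=; have [t0|t0] := leP 0 t; last by exists 0.
  have [Dz|nD] := pselect (D z); last by exists 0.
  have [K [cK KD KP]] := near_trapped (@compact_set1 _ (z : R[i]^o)) (pt_in_D Dz) t0.
  have [|l Kl lP] := @ultra_compact_limit _ _ F K (fun p => iter (nsteps t p) p.1 z) FU cK.
    apply: filterS2 near_pos KP => p [_ p0]; apply => //.
    by have /andP[] := nstepsP t0 p0.
  by exists l => _ _; split; [exact: KD|].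
have [u uP] := choice ex; exists (fun t z => u (t, z)) => t t0 z Dz.
exact: (uP (t, z)).
Qed.

Section limit_flow.
Variable u : R -> C -> C.
Hypothesis uP : forall t, 0 <= t -> forall z, D z ->
  D (u t z) /\ forall e : R, 0 < e -> \forall p \near F, nm (iter (nsteps t p) p.1 z - u t z) < e.

Lemma near_nsteps t : 0 <= t -> \forall p \near F, (nsteps t p)%:R * p.2 <= t.
Proof. by move=> t0; apply: filterS near_pos => p [_ p0]; have /andP[] := nstepsP t0 p0. Qed.

Lemma flow_lip t z : 0 <= t -> D z -> exists r L : R, [/\ 0 < r, 0 < L &
  forall w, nm (w - z) < r -> D w /\ nm (u t w - u t z) <= L * nm (w - z)].
Proof.
move=> t0 Dz; have [r [L [r0 L0 rL]]] := near_equilip Dz t0.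
have [r1 r10 r1D] := open_modulusP domain_open Dz.
exists (Num.min r r1), L; split=> //; first by rewrite lt_min r0.
move=> w; rewrite lt_min => /andP[wr /r1D Dw]; split=> //.
apply/ler_addgt0Pl => e e0; have e2 : 0 < e / 2 by rewrite divr_gt0.
have [_ /(_ _ e2) uz] := uP t0 Dz; have [_ /(_ _ e2) uw] := uP t0 Dw.
have [p [[h1 h2] [h3 h4]]] := filter_ex (filterI (filterI uz uw) (filterI rL (near_nsteps t0))).
have {}h3 := h3 _ h4 w wr; set k := nsteps t p in h1 h2 h3.
rewrite (_ : u t w - u t z = (iter k p.1 w - iter k p.1 z) -
   ((iter k p.1 w - u t w) - (iter k p.1 z - u t z))); last by ring.
apply: le_trans (ler_modulusB _ _) _.
have := ler_modulusB (iter k p.1 w - u t w) (iter k p.1 z - u t z); lra.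
Qed.

(** Pointwise convergence of equi-Lipschitz maps is locally uniform: a third of [e] for the polygon,
    a third for its limit and a third for the convergence at the centre. *)
Lemma flow_unif t (K : set R[i]^o) (e : R) : 0 <= t -> compact K -> K `<=` D -> 0 < e ->
  \forall p \near F, forall z : C, K z -> nm (iter (nsteps t p) p.1 z - u t z) < e.
Proof.
move=> t0 cK KD e0.
apply: (@compact_near _ K _ F (fun p z => nm (iter (nsteps t p) p.1 z - u t z) < e)) => // z Kz.
have Dz := KD z Kz; have e3 : 0 < e / 3 by rewrite divr_gt0.
have [r [L [r0 L0 rL]]] := near_equilip Dz t0.
have [r1 [L1 [r10 L10 rL1]]] := flow_lip t0 Dz.
have [_ /(_ _ e3) uz] := uP t0 Dz.
exists (Num.min (Num.min r r1) (Num.min (e / 3 / L) (e / 3 / L1))).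
  by rewrite !lt_min r0 r10 !divr_gt0.
apply: filterS2 (filterI rL (near_nsteps t0)) uz => p [h1 h2] h3 w.
rewrite !lt_min => /andP[/andP[wr /rL1[_ wr1]] /andP[wL wL1]].
have {}h1 := h1 _ h2 w wr; set k := nsteps t p in h1 h3 *.
move: wL wL1; rewrite !ltr_pdivlMr// => wL wL1.
rewrite (_ : iter k p.1 w - u t w = (iter k p.1 w - iter k p.1 z) +
   ((iter k p.1 z - u t z) - (u t w - u t z))); last by ring.
apply: le_lt_trans (ler_modulusD _ _) _.
have := ler_modulusB (iter k p.1 z - u t z) (u t w - u t z); lra.
Qed.

Lemma flow_holo t z : 0 <= t -> D z -> holo (u t) z.
Proof.
move=> t0 Dz; have [r r0 [K [cK KD zK]]] :=
  compact_fatten domain_open (@compact_set1 _ (z : R[i]^o)) (pt_in_D Dz).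
apply: (@holo_limit _ _ _ (r / 2)) => [|e e0]; first by rewrite divr_gt0.
have inK w : nm (w - z) <= 2 * (r / 2) -> K w by move=> wz; apply: (zK z) => //; lra.
have [p [[Up p0] h]] := filter_ex (filterI near_pos (flow_unif t0 cK KD e0)).
exists (iter (nsteps t p) p.1) => w /inK Kw; last exact/ltW/h.
exact: (U_holo (U_iter (nsteps t p) Up) (KD w Kw)).1.
Qed.

Lemma flow0 z : D z -> u 0 z = z.
Proof.
move=> Dz; apply/eqP; rewrite -subr_eq0 -modulus_eq0 -normr_le0 ger0_norm ?modulus_ge0//.
apply/ler_addgt0Pl => e e0; rewrite addr0.
have [_ /(_ _ e0) /filter_ex[p]] := uP (lexx 0) Dz.
by rewrite /nsteps mul0r truncn0 /= modulusB => /ltW.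
Qed.

(** The step counts of [s] and [t] add up to that of [s + t] or to one less; an additional step
    moves the point by at most [h * (M + 1)], which is negligible. *)
Lemma flow_add s t z : 0 <= s -> 0 <= t -> D z -> u s (u t z) = u (s + t) z.
Proof.
move=> s0 t0 Dz; have st0 : 0 <= s + t by rewrite addr_ge0.
have [Du ut] := uP t0 Dz; have [_ us] := uP s0 Du; have [_ ust] := uP st0 Dz.
have [r [L [r0 L0 rL]]] := near_equilip Du s0.
have [K [cK KD KP]] := near_trapped (@compact_set1 _ (z : R[i]^o)) (pt_in_D Dz) st0.
have [M M0 MP] := compact_bounded cK (fun z Kz => holo_cont (phih (KD z Kz))).
apply/eqP; rewrite -subr_eq0 -modulus_eq0 -normr_le0 ger0_norm ?modulus_ge0//.
apply/ler_addgt0Pl => e e0; rewrite addr0; have e4 : 0 < e / 4 by rewrite divr_gt0.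
have d0 : 0 < Num.min r (e / 4 / L) by rewrite lt_min r0 divr_gt0.
have c0 : 0 < Num.min 1 (e / 4 / (M + 1)) by rewrite lt_min ltr01 divr_gt0//; lra.
have [p [[[h1 h2] [h3 h4]] [h5 [[Up p0] h7]]]] := filter_ex (filterI
   (filterI (filterI (us _ e4) (ut _ d0)) (filterI (ust _ e4) rL))
   (filterI KP (filterI near_pos (FE cK KD c0)))).
have /andP[s1 s2] := nstepsP s0 p0; have /andP[t1 t2] := nstepsP t0 p0.
have /andP[st1 st2] := nstepsP st0 p0.
set a := nsteps s p in h1 s1 s2; set b := nsteps t p in h2 t1 t2.
set c := nsteps (s + t) p in h3 st1 st2.
have h : nm (iter a p.1 (iter b p.1 z) - iter a p.1 (u t z)) <= e / 4.
  move: h2; rewrite lt_min => /andP[h2 h2'].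
  apply: le_trans (h4 a s1 _ h2) _; move: h2'; rewrite ltr_pdivlMr// => /ltW; lra.
have h' : nm (iter c p.1 z - iter a p.1 (iter b p.1 z)) <= e / 4.
  rewrite -iterD; have [->|cab] := eqVneq c (a + b)%N; first by rewrite subrr modulus0 ltW.
  have -> : c = (a + b).+1.
    have l1 : (a + b < c.+1)%N.
      rewrite -(@ltr_nat R) -(ltr_pM2r p0) -natr1 natrD; lra.
    have l2 : (c < (a + b).+2)%N.
      by rewrite -(@ltr_nat R) -(ltr_pM2r p0) -!natr1 natrD; lra.
    by apply/eqP; rewrite eqn_leq -ltnS l2 /= ltn_neqAle eq_sym cab -ltnS l1.
  have Kab : K (iter (a + b) p.1 z) by apply: h5 => //; rewrite natrD mulrDl lerD.
  have [_ /andP[_]] := h7; rewrite lt_min => /andP[p1 pe] /(_ _ Kab).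
  rewrite /= modulusB => h8; set y := iter (a + b) p.1 z in Kab h8 *.
  rewrite (_ : y - p.1 y = (y - p.1 y - p.2%:C * phi y) + p.2%:C * phi y); last by ring.
  apply: le_trans (ler_modulusD _ _) _; rewrite modulusM modulus_real (gtr0_norm p0).
  have h9 : p.2 * nm (phi y) <= p.2 * M by rewrite ler_pM2l// MP.
  have h10 : nm (y - p.1 y - p.2%:C * phi y) <= p.2.
    by apply: le_trans h8 _; rewrite ler_piMl ?ge_min ?lexx// ltW.
  move: pe; rewrite ltr_pdivlMr; lra.
rewrite (_ : u s (u t z) - u (s + t) z = (iter c p.1 z - u (s + t) z) -
   ((iter a p.1 (u t z) - u s (u t z)) + ((iter a p.1 (iter b p.1 z) - iter a p.1 (u t z)) +
    (iter c p.1 z - iter a p.1 (iter b p.1 z))))); last by ring.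
apply: le_trans (ler_modulusB _ _) _.
have h8 := ler_modulusD (iter a p.1 (u t z) - u s (u t z)) ((iter a p.1 (iter b p.1 z) - iter a p.1 (u t z)) +
    (iter c p.1 z - iter a p.1 (iter b p.1 z))).
have := ler_modulusD (iter a p.1 (iter b p.1 z) - iter a p.1 (u t z)) (iter c p.1 z - iter a p.1 (iter b p.1 z)).
lra.
Qed.

(** The limit of [euler], whose time bound does not depend on the step; replacing [k * h] by [t]
    costs less than [h * nm (phi z)] plus a vanishing term. *)
Lemma flow_deriv (K : set R[i]^o) (e : R) : compact K -> K `<=` D -> 0 < e ->
  exists2 t0 : R, 0 < t0 & forall t, 0 <= t <= t0 -> forall z : C, K z ->
    nm (z - u t z - t%:C * phi z) <= e * t.
Proof.
move=> cK KD e_gt0; have [K1 [t1 [e1 [cK1 K1D t10 e10 KP]]]] := euler cK KD e_gt0.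
exists t1 => // t /andP[t0 tt1] z Kz; apply/ler_addgt0Pl => d d0.
have D0 : 0 < 1 + nm (phi z) by rewrite ltr_pwDl// modulus_ge0.
have d2 : 0 < d / (1 + nm (phi z)) by rewrite divr_gt0.
have [_ ut] := uP t0 (KD z Kz).
have ed : 0 < Num.min e1 (d / (1 + nm (phi z))) by rewrite lt_min e10.
have [p [[h1 h2] [_ p0]]] := filter_ex (filterI (filterI (ut _ d2) (FE cK1 K1D ed)) near_pos).
have /andP[k1 k2] := nstepsP t0 p0; set k := nsteps t p in h1 k1 k2.
have st : Euler_step K1 e1 p by apply: Euler_stepS h2; rewrite ?ge_min ?lexx.
have h3 := KP p st k (le_trans k1 tt1) z Kz.
have [_ /andP[_]] := h2; rewrite lt_min => /andP[_ pd] _.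
rewrite (_ : z - u t z - t%:C * phi z = (z - iter k p.1 z - (k%:R * p.2)%:C * phi z) +
  ((iter k p.1 z - u t z) - (t - k%:R * p.2)%:C * phi z)); last by rewrite rmorphB /=; ring.
apply: le_trans (ler_modulusD _ _) _.
have h4 := ler_modulusB (iter k p.1 z - u t z) ((t - k%:R * p.2)%:C * phi z).
have tk : 0 <= t - k%:R * p.2 by lra.
rewrite modulusM modulus_real (ger0_norm tk) in h4.
have h5 : (t - k%:R * p.2) * nm (phi z) <= d / (1 + nm (phi z)) * nm (phi z).
  by rewrite ler_wpM2r ?modulus_ge0//; lra.
have h6 : d / (1 + nm (phi z)) * nm (phi z) + d / (1 + nm (phi z)) = d.
  by rewrite -[X in _ + X]mulr1 -mulrDr [nm _ + 1]addrC divfK// gt_eqF.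
have h7 : e * (k%:R * p.2) <= e * t by rewrite ler_pM2l.
lra.
Qed.

End limit_flow.
End ultra_limit.

End flow.

(** * The criterion for generators and its stability *)

Lemma holo_Hol (E : set R[i]^o) (f : R[i]^o -> R[i]^o) :
  (forall z, D z -> holo f z /\ E (f z)) -> Hol D E f.
Proof.
by move=> h; split=> z Dz; [apply/derivable_cdiff; case: (h z Dz)|case: (h z Dz)].
Qed.

Lemma Hol_holo (E : set R[i]^o) (f : R[i]^o -> R[i]^o) z : Hol D E f -> D z -> holo f z.
Proof. by move=> [fd _] /fd/derivable_cdiff. Qed.

Definition infinitesimal (phi : C -> C) := forall (K : set R[i]^o) (e : R),
  compact K -> K `<=` D -> 0 < e -> exists p, Euler_step phi K e p.

Lemma infinitesimal_generators (phi : R[i]^o -> R[i]^o) :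
  relatively_closed (Hol D D) U -> Hol D setT phi -> infinitesimal phi -> generators D U phi.
Proof.
move=> [_ cU] hphi iphi; have phih z : D z -> holo phi z by exact: Hol_holo hphi.
(* Euler steps with growing compact sets and shrinking tolerances form a filter, proper by the
   criterion; it is then refined to an ultrafilter. *)
pose F0 := filter_from [set Ke : set R[i]^o * R | [/\ compact Ke.1, Ke.1 `<=` D & 0 < Ke.2]]
  (fun Ke => Euler_step phi Ke.1 Ke.2).
have F0P : ProperFilter F0.
  apply: filter_from_proper; last by move=> [K e] [/= cK KD e0]; exact: iphi.
  apply: filter_from_filter; first by exists (set0, 1); split => //; exact: compact0.
  move=> [K1 e1] [K2 e2] [/= c1 d1 p1] [/= c2 d2 p2].
  exists (K1 `|` K2, Num.min e1 e2) => /=.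
    by split; [exact: compactU|move=> z [/d1|/d2]|rewrite lt_min p1].
  by move=> p st; split; apply: Euler_stepS st => //=; rewrite ?ge_min ?lexx ?orbT.
have [F [FU F0F]] := ultraFilterLemma F0P.
have FE (K : set R[i]^o) (e : R) : compact K -> K `<=` D -> 0 < e ->
    \forall p \near F, Euler_step phi K e p.
  by move=> cK KD e0; apply: F0F; exists (K, e).
have [u uP] := flow_ex phih FU FE.
exists (u : R -> R[i]^o -> R[i]^o); last first.
  split => //; apply/family_cvgP => K cK KD e e0; have e2 : 0 < e / 2 by rewrite divr_gt0.
  have [t0 t00 tP] := flow_deriv phih FU FE uP cK KD e2.
  apply/near_at_right; exists t0 => // t /andP[tpos tt0] z Kz.
  have tt : 0 <= t <= t0 by rewrite !ltW.
  have := tP t tt z Kz.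
  have tC : t%:C != 0 :> C by rewrite -modulus_gt0 modulus_real normr_gt0 gt_eqF.
  rewrite (_ : z - u t z - t%:C * phi z = t%:C * ((z - u t z) / t%:C - phi z)); last first.
    by field.
  rewrite modulusM modulus_real gtr0_norm// mulrC ler_pM2r// => h.
  apply: le_lt_trans h _; lra.
split.
- move=> t t0; have Ht : Hol D D (u t).
    apply: holo_Hol => z Dz; split; first exact: (flow_holo phih FU FE uP t0 Dz).
    by have [] := uP t t0 z Dz.
  (* [V] is closed in the whole function space and has the same trace as [U] on [Hol D D], so it
     contains the Euler polygons and their limit [u t]. *)
  move: cU => /closed_subspaceP[V cV VU].
  have : (V `&` Hol D D) (u t).
    split=> //; apply: closed_family_mem cV _ => K cK KD e e0.
    have [p [[Up _] h]] := filter_ex (filterI (near_pos FU FE) (flow_unif phih FU FE uP t0 cK KD e0)).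
    exists (iter (nsteps t p) p.1) => //.
    have Ug := U_iter (nsteps t p) Up.
    have : (U `&` Hol D D) (iter (nsteps t p) p.1) by split=> //; case: semU => UH _ _; exact: UH.
    by rewrite -VU => -[].
  by rewrite VU => -[].
- by move=> z Dz; exact: (flow0 FU uP Dz).
- by move=> s t s0 t0 z Dz; exact: (flow_add phih FU FE uP s0 t0 Dz).
- apply/family_cvgP => K cK KD e e0.
  have [t0 t00 tP] := flow_deriv phih FU FE uP cK KD (@ltr01 R).
  have [M M0 MP] := compact_bounded cK (fun z Kz => holo_cont (phih z (KD z Kz))).
  apply/near_at_right; exists (Num.min t0 (e / (1 + M))).
    by rewrite lt_min t00 divr_gt0//; lra.
  move=> t; rewrite lt_min => /and3P[tpos tt0 te] z Kz.
  have tt : 0 <= t <= t0 by rewrite !ltW.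
  have h := tP t tt z Kz; rewrite mul1r in h.
  rewrite modulusB (_ : z - u t z = (z - u t z - t%:C * phi z) + t%:C * phi z); last by ring.
  apply: le_lt_trans (ler_modulusD _ _) _; rewrite modulusM modulus_real gtr0_norm//.
  have h2 : t * nm (phi z) <= t * M by rewrite ler_pM2l// MP.
  move: te; rewrite ltr_pdivlMr; lra.
Qed.

Lemma generator_steps (phi : R[i]^o -> R[i]^o) (a : R) : generators D U phi -> 0 <= a ->
  exists V : R -> C -> C, (forall h, 0 <= h -> U (V h)) /\
    forall (K : set R[i]^o) (e : R), compact K -> K `<=` D -> 0 < e ->
      exists2 d : R, 0 < d & forall h, 0 < h < d -> forall z : C, K z ->
        nm (z - V h z - h%:C * (a%:C * phi z)) <= e * h.
Proof.
move=> [v [vU v0 _ _] [_ /family_cvgP vphi]] a0.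
exists (fun h => v (a * h)); split=> [h h0|K e cK KD e0]; first by apply: vU; rewrite mulr_ge0.
(* For [a = 0] the maps are all [v 0], the identity on [D]; the tolerance [e / a] used below would
   be meaningless. *)
have [->|an0] := eqVneq a 0.
  exists 1 => // h /andP[h0 _] z Kz; rewrite mul0r (v0 _ (KD z Kz)).
  by rewrite subrr !(mul0r, mulr0) subrr modulus0 mulr_ge0// ltW.
have apos : 0 < a by rewrite lt0r an0.
have ea : 0 < e / a by rewrite divr_gt0.
have /near_at_right[d d0 dP] := vphi K cK KD _ ea.
exists (d / a) => [|h /andP[h0 hd] z Kz]; first by rewrite divr_gt0.
have ah : 0 < a * h by rewrite mulr_gt0.
have ahd : 0 < a * h < d by rewrite ah mulrC -ltr_pdivlMr.
have := dP _ ahd z Kz.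
have tC : (a * h)%:C != 0 :> C by rewrite -modulus_gt0 modulus_real normr_gt0 gt_eqF.
move=> hh; rewrite (_ : z - _ - _ = (a * h)%:C * ((z - v (a * h) z) / (a * h)%:C - phi z)); last first.
  by rewrite mulrBr [X in _ = X - _]mulrC mulfVK// rmorphM /=; ring.
rewrite modulusM modulus_real gtr0_norm//.
have -> : e * h = (a * h) * (e / a) by field.
by rewrite ler_pM2l// ltW.
Qed.

(** The composite [V h \o W h] displaces [z] by nearly [h] times [b g z + a f (W h z)], and [W h z]
    is close to [z]. The estimate for [V] is taken on a neighbourhood of [K], where [W h z]
    lands. *)
Lemma generators_cone (f g : R[i]^o -> R[i]^o) (a b : R) : 0 <= a -> 0 <= b ->
  generators D U f -> generators D U g ->
  infinitesimal (fun z => a%:C * f z + b%:C * g z).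
Proof.
move=> a0 b0 Gf Gg K e cK KD e0; have e3 : 0 < e / 3 by rewrite divr_gt0.
have fh z : D z -> holo (fun z => a%:C * f z) z.
  case: Gf => _ _ [Hf _] Dz; apply: holoM; [exact: holo_cst|exact: Hol_holo Hf Dz].
have gh z : D z -> holo (fun z => b%:C * g z) z.
  case: Gg => _ _ [Hg _] Dz; apply: holoM; [exact: holo_cst|exact: Hol_holo Hg Dz].
have [r r0 [K1 [cK1 K1D K1P]]] := compact_fatten domain_open cK KD.
have [V [VU VP]] := generator_steps Gf a0; have [W [WU WP]] := generator_steps Gg b0.
have [M M0 MP] := compact_bounded cK (fun z Kz => holo_cont (gh z (KD z Kz))).
have [d d0 dP] := compact_equicont cK (fun z Kz => holo_cont (fh z (KD z Kz))) e3.
have [d1 d10 d1P] := VP K1 _ cK1 K1D e3.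
have e31 : 0 < Num.min 1 (e / 3) by rewrite lt_min ltr01.
have [d2 d20 d2P] := WP K _ cK KD e31.
pose m := Num.min (Num.min d1 d2) (Num.min e (Num.min d r / (1 + M))).
have m0 : 0 < m by rewrite !lt_min d10 d20 e0 divr_gt0//; [rewrite lt_min d0|lra].
have [h h0 hm] : exists2 h : R, 0 < h & h < m by exists (m / 2); lra.
move: hm; rewrite !lt_min => /andP[/andP[hd1 hd2] /andP[he]].
rewrite ltr_pdivlMr ?lt_min; last lra.
move=> /andP[hd hr]; exists (V h \o W h, h); split => /=.
- by case: semU => _ _; apply; [apply: VU|apply: WU]; exact: ltW.
- by rewrite h0.
move=> z Kz; have h02 : 0 < h < d2 by rewrite h0.
have h01 : 0 < h < d1 by rewrite h0.
have h1 := d2P h h02 z Kz.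
have h2 : nm (W h z - z) <= h * (1 + M).
  rewrite modulusB (_ : z - W h z = (z - W h z - h%:C * (b%:C * g z)) + h%:C * (b%:C * g z)); last by ring.
  apply: le_trans (ler_modulusD _ _) _; rewrite [nm (h%:C * _)]modulusM modulus_real gtr0_norm//.
  have h3 : h * nm (b%:C * g z) <= h * M by rewrite ler_pM2l// MP.
  have h4 : Num.min 1 (e / 3) * h <= h by rewrite ler_piMl ?ge_min ?lexx// ltW.
  lra.
have h3 : nm (a%:C * f (W h z) - a%:C * f z) < e / 3.
  by apply: dP => //; apply: le_lt_trans h2 _.
have h4 : K1 (W h z) by apply: (K1P z) => //; apply/ltW/(le_lt_trans h2).
have h5 := d1P h h01 _ h4.
have h6 : Num.min 1 (e / 3) * h <= e / 3 * h by rewrite ler_pM2r// ge_min lexx orbT.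
have h7 : h * nm (a%:C * f (W h z) - a%:C * f z) <= h * (e / 3) by rewrite ler_pM2l// ltW.
rewrite (_ : z - _ - _ = (W h z - V h (W h z) - h%:C * (a%:C * f (W h z))) +
  ((z - W h z - h%:C * (b%:C * g z)) + h%:C * (a%:C * f (W h z) - a%:C * f z))); last by ring.
apply: le_trans (ler_modulusD _ _) _.
have := ler_modulusD (z - W h z - h%:C * (b%:C * g z)) (h%:C * (a%:C * f (W h z) - a%:C * f z)).
rewrite [nm (h%:C * (_ - _))]modulusM modulus_real gtr0_norm// => h8.
lra.
Qed.

Lemma generators_infinitesimal (f : R[i]^o -> R[i]^o) : generators D U f -> infinitesimal f.
Proof.
move=> Gf K e cK KD e0.
have [p [Up hp pP]] := @generators_cone f f 1 0 ler01 (lexx 0) Gf Gf K e cK KD e0.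
exists p; split=> // z Kz; have := pP z Kz.
by rewrite mul1r mul0r addr0.
Qed.

End Generators.

Theorem theorem1 (R : realType) (D : set R[i]^o)
    (U : set {family compactly_in D, R[i]^o -> R[i]^o})
    (hD : simply_connected_domain D) (hDC : D <> setT)
    (hU : semigroup_of_self_maps D U)
    (hUclosed : relatively_closed (Hol D D) U) :
  real_convex_cone (generators D U) /\
  relatively_closed (Hol D setT) (generators D U).
Proof.
have genH f : generators D U f -> Hol D setT f by case=> v _ [].
split; split=> //.
- exists (fun=> 0); apply: infinitesimal_generators => //.
  (* For the zero function the identity is an exact Euler step of any length. *)
  move=> K e cK KD e0; exists (idfun, e / 2); split => /=.
  + by case: hU.
  + by lra.
  + by move=> z Kz; rewrite subrr mulr0 subrr modulus0 mulr_ge0//; lra.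
- move=> a b f g a0 b0 Gf Gg; apply: (infinitesimal_generators hD hDC hU hUclosed).
    2: exact: generators_cone.
  apply: holo_Hol => z Dz; split=> //.
  by apply: holoD; apply: holoM; [exact: holo_cst|exact: Hol_holo (genH _ Gf) Dz|
     exact: holo_cst|exact: Hol_holo (genH _ Gg) Dz].
(* A holomorphic limit [f] satisfies the criterion: a step for a nearby generator [g] with tolerance
   [e / 2] is a step for [f] with tolerance [e]. *)
- apply/closed_subspaceP; exists (closure (generators D U)); first exact: closed_closure.
  apply/seteqP; split=> f [Gf Hf]; split=> //; last exact: subset_closure.
  apply: infinitesimal_generators => // K e cK KD e0; have e2 : 0 < e / 2 by rewrite divr_gt0.
  have [g Gg gf] := closure_family_mem Gf cK KD e2.
  have [[q h] [/= Uq hq qP]] := generators_infinitesimal hD hU Gg cK KD e2.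
  exists (q, h); split=> //=; first lra.
  move=> z Kz; have h0 : 0 < h by lra.
  rewrite (_ : z - q z - h%:C * f z = (z - q z - h%:C * g z) + h%:C * (g z - f z)); last by ring.
  apply: le_trans (ler_modulusD _ _) _; rewrite modulusM modulus_real gtr0_norm//.
  have h1 : h * nm (g z - f z) <= h * (e / 2) by rewrite ler_pM2l// ltW// gf.
  have := qP z Kz; lra.
Qed.
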